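(* Let $r,p,\tau,\alpha,\beta$ be as in the context, and consider the equation $$(E)\qquad (r(t)\Phi(y'))'=p(t)\Phi(y(\tau(t))).$$ Assume that $\int_a^\infty r^{1-\beta}(s)\,ds=\infty$, and put $R_D(t)=\int_a^tr^{1-\beta}(s)\,ds$, $$\tau_D=R_D\circ\tau\circ R_D^{-1},\qquad p_D=(pr^{\beta-1})\circ R_D^{-1},\qquad q_D=\big((\tau_D'\circ R_D)R_D\big)^{\alpha-1}p.$$ Assume that $p_D\in\mathcal{RV}(-\alpha)$ and $\lim_{t\to\infty}L_{p_D}(t)=0$. Let $\tau\in C^1$, $\tau'>0$, $\tau(t)\le t$, and $$\limsup_{t\to\infty}\frac{t}{\tau_D(t)}<\infty,\qquad\tau_D'\in\mathcal{SV},\qquad\limsup_{t\to\infty}\tau_D'(t)<\infty.$$ Then for any $y\in\mathcal{IS}$ one has $y\circ R_D^{-1}\in\mathcal{NRV}(1)$ and the following hold. (i) If $\int_a^\infty q_D(s)\,ds=\infty$, then $$y(t)=R_D(t)\exp\left\{\int_a^t(1+o(1))(\beta-1)q_D(s)\,ds\right\}\quad\text{as }t\to\infty,$$ and $y\in\mathcal{IS}_{\infty,\infty}$. (ii) If $\int_a^\infty q_D(s)\,ds<\infty$, then $$y(t)=A+\int_a^tM^{\beta-1}r^{1-\beta}(s)\exp\left\{-\int_s^\infty(1+o(1))(\beta-1)q_D(u)\,du\right\}ds\quad\text{as }t\to\infty,$$ and $y\in\mathcal{IS}_{\infty,B}$, with $\lim_{t\to\infty}y^{[1]}(t)=M\in(0,\infty)$,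 for some $A\in\mathbb R$. In addition, $|y^{[1]}\circ R_D^{-1}-M|\in\mathcal{SV}$ and $$\frac{(\tau_D'(R_D(t)))^{\alpha-1}R_D^\alpha(t)p(t)r^{\beta-1}(t)}{M-y^{[1]}(t)}=o(1)\quad\text{as }t\to\infty.$$
   Context: Setting. $a>0$; $r,p:[a,\infty)\to(0,\infty)$ are continuous; $\alpha>1$, $\Phi(u)=|u|^{\alpha-1}\operatorname{sgn}u$; $\beta$ is the conjugate number of $\alpha$, $1/\alpha+1/\beta=1$. The delay $\tau$ is a function on $[a,\infty)$. $R_D^{-1}$ denotes the inverse function of $R_D$. Solutions. A solution $y$ of (E) is a $C^1$ function on an interval $I\subseteq[a,\infty)$ with $r\Phi(y')\in C^1(I)$ satisfying the equation. $\mathcal S$ is the set of $y$ that are positive solutions of (E) for all large $t$. $\mathcal{IS}=\{y\in\mathcal S: y'(t)>0\text{ for large }t\}$. Quasiderivative: $y^{[1]}=r\Phi(y')$. For $u,v\in\{B,\infty\}$, $\mathcal{IS}_{u,v}=\{y\in\mathcal{IS}:\lim_{t\to\infty}y(t)=u,\ \lim_{t\to\infty}y^{[1]}(t)=v\}$, where the value $B$ means that the corresponding limit is a finite nonzero real number. Regular variation. A measurable $f:[a,\infty)\to(0,\infty)$ (positivity and all statements for large $t$ suffice) is in $\mathcal{RV}(\vartheta)$, $\vartheta\in\mathbb R$, if $\lim_{t\to\infty}f(\lambda t)/f(t)=\lambda^\vartheta$ for every $\lambda>0$; $\mathcal{SV}=\mathcal{RV}(0)$. For $f\in\mathcal{RV}(\vartheta)$,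 $L_f(t)=f(t)/t^\vartheta$; thus $L_{p_D}(s)=s^\alpha p_D(s)$. $f\in\mathcal{NRV}(\vartheta)$ (normalized) if $f(t)=Ct^\vartheta\exp\{\int_{t_0}^t\psi(s)/s\,ds\}$ for large $t$, with $C\in(0,\infty)$ and $\psi$ measurable, $\psi(t)\to0$; for $f\in C^1$ this is equivalent to $tf'(t)/f(t)\to\vartheta$. Conventions. $\tau_D$ and $q_D$ are considered for arguments so large that they are defined (i.e. $\tau\ge a$ at the relevant point); where necessary the lower limit $a$ in integrals involving $q_D$ is replaced by a sufficiently large number. Inside an integral, $1+o(1)$ stands for $1+\varepsilon(\cdot)$ evaluated at the integration variable, for some function $\varepsilon$ tending to $0$ at infinity; the formulas hold for all large $t$. *)

(* Defs.v *)
From HB Require Import structures.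
From mathcomp Require Import all_boot all_order all_algebra.
From mathcomp Require Import all_classical all_reals all_analysis.
Set Implicit Arguments.
Unset Strict Implicit.
Unset Printing Implicit Defensive.
Import Order.TTheory GRing.Theory Num.Theory.
Import numFieldNormedType.Exports.
Local Open Scope classical_set_scope.
Local Open Scope ring_scope.

Notation leb R := (@lebesgue_measure R) (only parsing).

(* Derivative relative to [I]: one-sided at an endpoint belonging to [I], and
   equal to the ordinary derivative in the interior. *)
Definition derivative_on (R : realType) (I : set R) (f f' : R -> R) : Prop :=
  forall t, I t -> (f s - f t) / (s - t) @[s --> within I t^'] --> f' t.

Definition C1_on (R : realType) (I : set R) (f f' : R -> R) : Prop :=
  derivative_on I f f' /\ {within I, continuous f'}.

Definition Phi (R : realType) (alpha u : R) : R :=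
  `|u| `^ (alpha - 1) * Num.sg u.

(* The equation can only be required at those [t] for which the delayed
   argument lies in the domain [I] of [y]. *)
Definition solution (R : realType) (a alpha : R) (r p tau : R -> R)
    (I : set R) (y : R -> R) : Prop :=
  [/\ is_interval I, I `<=` `[a, +oo[ &
    exists y' w' : R -> R,
      [/\ C1_on I y y',
          C1_on I (fun t => r t * Phi alpha (y' t)) w' &
          forall t, I t -> I (tau t) -> w' t = p t * Phi alpha (y (tau t))]].

Definition sol_S (R : realType) (a alpha : R) (r p tau y : R -> R) : Prop :=
  exists I : set R,
    [/\ solution a alpha r p tau I y, ~ has_ubound I &
        \forall t \near +oo, 0 < y t].

Definition sol_IS (R : realType) (a alpha : R) (r p tau y : R -> R) : Prop :=
  sol_S a alpha r p tau y /\ \forall t \near +oo, 0 < derive1 y t.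

Definition quasi (R : realType) (alpha : R) (r y : R -> R) (t : R) : R :=
  r t * Phi alpha (derive1 y t).

Inductive lim_value : Set := LimB | LimInfty.

Definition has_lim_value (R : realType) (u : lim_value) (f : R -> R) : Prop :=
  match u with
  | LimB => exists2 l : R, l != 0 & f t @[t --> +oo] --> l
  | LimInfty => f t @[t --> +oo] --> +oo
  end.

Definition sol_ISuv (R : realType) (a alpha : R) (r p tau : R -> R)
    (u v : lim_value) (y : R -> R) : Prop :=
  [/\ sol_IS a alpha r p tau y, has_lim_value u y &
      has_lim_value v (quasi alpha r y)].

Definition RV (R : realType) (theta : R) (f : R -> R) : Prop :=
  [/\ \forall b \near +oo, measurable_fun (`[b, +oo[ : set R) f,
      \forall t \near +oo, 0 < f t &
      forall lambda : R, 0 < lambda ->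
        f (lambda * t) / f t @[t --> +oo] --> lambda `^ theta].

Definition SV (R : realType) (f : R -> R) : Prop := RV 0 f.

Definition Lpart (R : realType) (theta : R) (f : R -> R) (t : R) : R :=
  f t / t `^ theta.

Definition NRV (R : realType) (theta : R) (f : R -> R) : Prop :=
  exists (t0 C : R) (psi : R -> R),
    [/\ 0 < t0 /\ 0 < C,
        measurable_fun (`[t0, +oo[ : set R) psi,
        psi t @[t --> +oo] --> 0,
        forall t, t0 <= t ->
          (leb R).-integrable `[t0, t] (fun s => (psi s / s)%:E) &
        \forall t \near +oo, f t = C * t `^ theta *
          expR (\int[leb R]_(s in `[t0, t]) (psi s / s))].

Section Transformed.
Context (R : realType) (a alpha beta : R) (r p tau : R -> R).

Definition R_D (t : R) : R :=
  \int[leb R]_(s in `[a, t]) (r s `^ (1 - beta)).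

Definition R_Dinv : R -> R := pinv `[a, +oo[ R_D.

Definition tau_D : R -> R := R_D \o tau \o R_Dinv.

Definition p_D : R -> R := (fun t => p t * r t `^ (beta - 1)) \o R_Dinv.

Definition q_D (t : R) : R :=
  (derive1 tau_D (R_D t) * R_D t) `^ (alpha - 1) * p t.

End Transformed.

(* Main.v *)
Require Import Defs.
From HB Require Import structures.
From mathcomp Require Import all_boot all_order all_algebra.
From mathcomp Require Import all_classical all_reals all_analysis.
From mathcomp Require Import measurable_realfun ring lra.
Set Implicit Arguments.
Unset Strict Implicit.
Unset Printing Implicit Defensive.
Import Order.TTheory GRing.Theory Num.Theory.
Import numFieldNormedType.Exports.
Local Open Scope classical_set_scope.
Local Open Scope ring_scope.

(** In the variable s = R_D(t), with x = y o R_D^-1, the equation becomes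
    (Phi(x'))' = p_D Phi(x o tau_D), where w = Phi(x') is the quasiderivative of y.
    Since x <= 2 s x' for large s, s w'/w is at most a constant times L_{p_D}(s),
    hence tends to 0. So w and x' are slowly varying, and Karamata's theorem gives
    x ~ s x'. Applied to tau_D' it gives tau_D ~ s tau_D', so that
    x o tau_D ~ s tau_D' x' and w'/w ~ Q, where Q(s) ds is q_D(t) dt. Applied to
    (s x' - x)' = s x'' it gives s x' - x ~ (beta - 1) s Q x, which is
    (ln (x / s))' ~ (beta - 1) Q, the formula in (i). If w tends to a finite M,
    then s w' is slowly varying, so that M - w dominates it; integrating w'/w ~ Q
    from s to infinity gives the formula in (ii). *)

(** * Slow variation *)

(** Slow variation is a limit for each fixed ratio, whereas the ratio of the delayed argument to the
    current one moves with the variable. The bound on [t / tau_D t] keeps this ratio in some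
    [[c, 1]], and on that range uniformity is required. For the quasiderivative it comes from its
    small logarithmic derivative; for functions that are merely continuous, such as [tau_D'], it
    comes from a category argument. Regular variation of [p_D] gives more than the decay of
    $L_{p_D}$: it makes $sQ(s)$, the product of $(\tau_D')^{\alpha-1}$ and $L_{p_D}$, slowly
    varying. This is what admits Karamata's theorem for $s x''$ and the comparison of $M - w$ with
    $s w'$. The functions [1 + o(1)] are solved for rather than estimated. On a ray they are the
    quotient of an exact derivative by its equivalent. Before that ray they are free: in (i) this
    freedom absorbs the constant of integration, in (ii) the constant [A] does. *)

Definition slow (R : realType) (f : R -> R) : Prop :=
  forall l : R, 0 < l -> f (l * t) / f t @[t --> +oo] --> (1 : R).

(** * Uniformity of the limit over ratios in a compact interval *)

Section UniformConvergence.
Context {R : realType}.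
Implicit Types f g h : R -> R.

(* Baire: the closed sets of shifts [u] along which [h] oscillates by at most
   [e / 3] from rank [n] on cover the line, so one contains an interval; finitely
   many pointwise limits then move this interval across [0, 1]. *)
Lemma uniform_convergence_additive h : continuous h ->
  (forall u, h (x + u) - h x @[x --> +oo] --> (0 : R)) ->
  forall e : R, 0 < e -> \forall x \near +oo,
    forall u, 0 <= u <= 1 -> `|h (x + u) - h x| <= e.
Proof.
move=> ch hu e e0.
pose d := e / 3.
have d0 : 0 < d by rewrite divr_gt0.
pose A (n : nat) := [set u : R | forall x : R, n%:R <= x -> `|h (x + u) - h x| <= d].
have oA n : open (~` A n).
  rewrite openE => u /= /existsNP[x /not_implyP[nx /negP]]; rewrite -ltNge => dx.
  have : (fun v => `|h (x + v) - h x|) v @[v --> u] --> `|h (x + u) - h x|.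
    apply: cvg_norm; apply: cvgB; last exact: cvg_cst.
    apply: (@cvg_comp _ _ _ (fun v => x + v) h); last exact: ch.
    by apply: cvgD; [exact: cvg_cst|exact: cvg_id].
  move=> /cvgr_gt/(_ _ dx); apply: filterS => v /= dv Av.
  by move: dv; rewrite ltNge Av.
have [n nA] : exists n, ~ dense (~` A n).
  apply/existsNP => dA.
  have /Baire : forall n, open (~` A n) /\ dense (~` A n) by move=> n; split.
  move=> /(_ setT); case; first by exists 0.
    exact: openT.
  move=> u [_ /= Hu].
  have /cvgr0Pnorm_le/(_ _ d0) := hu u.
  move=> [X [Xr HX]].
  have [n Xn] : exists n : nat, X < n%:R.
    by exists (Num.truncn `|X|).+1; rewrite (le_lt_trans (ler_norm _))// truncnS_gt.
  apply: (Hu n Logic.I) => x nx; apply: HX.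
  exact: lt_le_trans nx.
have [V [[u0 Ou0] oO OA]] : exists V, [/\ V !=set0, open V & V `<=` A n].
  move: nA => /existsNP[V /not_implyP[V0 /not_implyP[oO O1]]].
  exists V; split => // u Ou; apply: contrapT => nAu.
  by apply: O1; exists u.
have [r r0 Hr] : exists2 r : R, 0 < r & forall v, 0 <= v <= r -> A n (u0 + v).
  have /nbhs_ballP[r /= r0 rO] : nbhs u0 V by exact: open_nbhs_nbhs.
  exists (r / 2); first by rewrite divr_gt0.
  move=> v /andP[v0 vr]; apply: OA; apply: rO => /=.
  rewrite /ball /= opprD addrA subrr sub0r normrN ger0_norm//.
  by rewrite (le_lt_trans vr)// ltr_pdivrMr// mulr_natr mulr2n ltrDl.
(* Comparing the shifts [u0 + v] and [u0] from the base point [z - u0] eliminates [u0]. *)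
have step v : 0 <= v <= r -> forall z, n%:R + u0 <= z -> `|h (z + v) - h z| <= d + d.
  move=> vr z nz.
  have H1 := Hr _ vr (z - u0).
  have H2 := Hr 0 _ (z - u0).
  have E1 : z - u0 + (u0 + v) = z + v by ring.
  have E2 : z - u0 + (u0 + 0) = z by ring.
  rewrite E1 in H1; rewrite E2 in H2.
  have -> : h (z + v) - h z = (h (z + v) - h (z - u0)) - (h z - h (z - u0)) by ring.
  have nz' : n%:R <= z - u0 by rewrite lerBrDr.
  by rewrite (le_trans (ler_normB _ _))// lerD// ?H1// H2// lexx ltW.
(* [N] steps of length [r] cover [[0, 1]]. The grid point below [u] costs [d], the remaining shift,
   smaller than [r], costs [2 * d]. *)
pose N := (Num.truncn r^-1).+1.
have rN : 1 <= r * N%:R.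
  by rewrite -ler_pdivrMl// mulr1 ltW// truncnS_gt.
have grid : \forall z \near +oo, forall i : 'I_N, `|h (z + r * i%:R) - h z| <= d.
  apply: filter_forall => i.
  by have /cvgr0Pnorm_le/(_ _ d0) := hu (r * i%:R).
near=> z => u /andP[u0' u1].
pose k := Num.truncn (u / r).
have kN : (k < N.+1)%N.
  rewrite ltnS truncn_le_nat.
  rewrite ltr_pdivrMr//.
  rewrite (le_lt_trans u1)// (le_lt_trans rN)// mulrC ltr_pM2r// ltr_nat//.
have Hk : k%:R <= u / r < k.+1%:R.
  by apply: truncn_itv; rewrite divr_ge0// ltW.
have kN' : (k < N)%N.
  rewrite ltnS truncn_le_nat.
  rewrite (@le_lt_trans _ _ r^-1)//; last exact: truncnS_gt.
  by rewrite -[leRHS]mul1r ler_wpM2r// invr_ge0 ltW.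
have gk : `|h (z + r * k%:R) - h z| <= d.
  have : forall i : 'I_N, `|h (z + r * i%:R) - h z| <= d by near: z.
  by move=> /(_ (Ordinal kN')).
have Ev : z + u = (z + r * k%:R) + (u - r * k%:R) by ring.
have -> : h (z + u) - h z =
  (h ((z + r * k%:R) + (u - r * k%:R)) - h (z + r * k%:R)) + (h (z + r * k%:R) - h z).
  by rewrite Ev; ring.
have -> : e = (d + d) + d by rewrite /d; lra.
rewrite (le_trans (ler_normD _ _))// lerD//.
apply: step.
  move: Hk; rewrite ler_pdivlMr// ltr_pdivrMr// => /andP[k1 k2].
  rewrite -natr1 in k2.
  apply/andP; split; nra.
by rewrite (@le_trans _ _ z)// lerDl mulr_ge0// ltW.
Unshelve. all: by end_near. Qed.

Lemma near_pinfty_ge (P : R -> Prop) : (\forall t \near +oo, P t) ->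
  exists2 X : R, 0 < X & forall t, X <= t -> P t.
Proof.
move=> [X [_ HX]]; exists (`|X| + 1); first by rewrite ltr_wpDl.
move=> t Xt; apply: HX; apply: lt_le_trans Xt.
by rewrite (le_lt_trans (ler_norm _))// ltrDl.
Qed.

Lemma near_pinfty_scale (c : R) (P : R -> Prop) : 0 < c ->
  (\forall t \near +oo, P t) -> \forall t \near +oo, P (c * t).
Proof.
move=> c0 [X [_ HX]]; exists (X / c); split; first exact: num_real.
by move=> t; rewrite ltr_pdivrMr// mulrC; exact: HX.
Qed.

Lemma cvg_pinfty_scale (c : R) : 0 < c -> c * t @[t --> +oo] --> +oo.
Proof. by move=> c0; apply: gt0_cvgMry => //; exact: cvg_id. Qed.

Lemma cvg_expR_pinfty : expR x @[x --> +oo] --> (+oo : set_system R).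
Proof.
apply: (@ger_cvgy _ _ _ _ id) => //; near=> x.
by rewrite (le_trans _ (expR_ge1Dx _))// lerDr.
Unshelve. all: by end_near. Qed.

(** With [h] the logarithm of [f] in an exponential variable, ratios become shifts; [u] in
    [[s, 2 * s]] is a shift by [ln (u / s) <= u / s - 1 <= 1]. *)
Lemma uniform_convergence f :
  (\forall t \near +oo, 0 < f t) ->
  (\forall t \near +oo, {for t, continuous f}) -> slow f ->
  forall e : R, 0 < e -> \forall s \near +oo,
    forall u, s <= u <= 2 * s -> `|f u / f s - 1| <= e.
Proof.
move=> fp cf sf e e0.
have [X X0 HX] : exists2 X : R, 0 < X &
    forall t, X <= t -> 0 < f t /\ {for t, continuous f}.
  by apply: near_pinfty_ge; apply: filterS2 fp cf.
(* The maximum with [X] makes [h] continuous on the whole line, as the additive lemma demands, and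
   changes nothing near infinity. *)
pose h x := ln (f (Num.max (expR x) X)).
have ch : continuous h.
  move=> x; apply: (@continuous_comp _ _ _ _ (@ln R)); last first.
    by apply: continuous_ln; apply: (HX _ _).1; rewrite le_max lexx orbT.
  apply: (@continuous_comp _ _ _ (fun x => Num.max (expR x) X) f).
    by apply: continuous_max; [exact: continuous_expR|exact: cst_continuous].
  by apply: (HX _ _).2; rewrite le_max lexx orbT.
have [d d0 Hd] : exists2 d : R, 0 < d & forall v, `|v| <= d -> `|expR v - 1| <= e.
  have := @continuous_expR R 0; rewrite /continuous_at expR0.
  move=> /cvgrPdist_le/(_ _ e0)/nbhs_ballP[d /= d0 Hd].
  exists (d / 2); first by rewrite divr_gt0.
  move=> v vd; rewrite distrC; apply: Hd => /=.
  by rewrite /ball /= sub0r normrN (le_lt_trans vd)// ltr_pdivrMr// mulr_natr mulr2n ltrDl.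
have hE x : X <= expR x -> h x = ln (f (expR x)).
  by move=> xX; rewrite /h max_l.
have hcv u : h (x + u) - h x @[x --> +oo] --> (0 : R).
  have H : ln (f (expR u * expR x) / f (expR x)) @[x --> +oo] --> ln (1 : R).
    apply: (@continuous_cvg _ _ _ _ _ _ (@ln R)); first exact: continuous_ln.
    apply: (@cvg_comp _ _ _ expR (fun t => f (expR u * t) / f t)); last first.
      exact/sf/expR_gt0.
    exact: cvg_expR_pinfty.
  rewrite ln1 in H; apply: cvg_trans H; apply: near_eq_cvg; near=> x.
  have xX : X <= expR x.
    by near: x; move: cvg_expR_pinfty => /cvgryPge; apply.
  have uxX : X <= expR u * expR x.
    near: x.
    have : expR u * expR x @[x --> +oo] --> (+oo : set_system R).
      by apply: gt0_cvgMry; [exact: expR_gt0|exact: cvg_expR_pinfty].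
    by move/cvgryPge; apply.
  have uxX' : X <= expR (x + u) by rewrite expRD mulrC.
  rewrite hE// hE// expRD [expR x * expR u]mulrC ln_div// posrE.
    exact: (HX _ uxX).1.
  exact: (HX _ xX).1.
have [Y Y0 HY] := near_pinfty_ge (uniform_convergence_additive ch hcv d0).
near=> s => u /andP[su us].
have Xs : X <= s by near: s; apply: nbhs_pinfty_ge; rewrite num_real.
have s0 : 0 < s by exact: lt_le_trans Xs.
have u0 : 0 < u by exact: lt_le_trans su.
have Ys : Y <= ln s.
  by rewrite -ler_expR lnK ?posrE.
have := HY _ Ys (ln u - ln s).
rewrite [ln s + _]addrC subrK hE; last by rewrite lnK ?posrE// (le_trans Xs).
rewrite hE; last by rewrite lnK ?posrE.
rewrite !lnK ?posrE//.
have fu : 0 < f u by apply: (HX _ _).1; exact: le_trans su.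
have fs : 0 < f s by apply: (HX _ _).1.
move=> H; have {H}/Hd : `|ln (f u) - ln (f s)| <= d.
  apply: H; rewrite subr_ge0 ler_ln ?posrE// su/=.
  rewrite -ln_div ?posrE// (@le_trans _ _ (u / s - 1))//.
    rewrite -ler_expR lnK ?posrE ?divr_gt0//.
    by rewrite (le_trans _ (expR_ge1Dx _))// addrC subrK.
  by rewrite lerBlDr ler_pdivrMr//.
by rewrite -ln_div ?posrE// lnK ?posrE ?divr_gt0.
Unshelve. all: by end_near. Qed.

(** Halvings lead from any [t] down to [[S, 2 * S]], where continuity bounds [e]. The first
    induction propagates this bound to the whole ray; the second shows that all of it but [4 * d]
    decays geometrically. *)
Lemma halving_contraction (e : R -> R) :
  (\forall t \near +oo, {for t, continuous e}) ->
  (forall d : R, 0 < d -> \forall s \near +oo,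
     `|e s| <= 3 / 4 * `|e (s / 2)| + d) ->
  e t @[t --> +oo] --> (0 : R).
Proof.
move=> ce He; apply/cvgr0Pnorm_le => eps eps0.
pose d := eps / 8.
have d0 : 0 < d by rewrite divr_gt0.
have [S S0 HS] : exists2 S : R, 0 < S & forall t, S <= t ->
    {for t, continuous e} /\ `|e t| <= 3 / 4 * `|e (t / 2)| + d.
  by apply: near_pinfty_ge; apply: filterS2 ce (He _ d0).
have [M M0 HM] : exists2 M : R, 0 <= M & forall t, S <= t <= 2 * S -> `|e t| <= M.
  have S2 : S <= 2 * S by lra.
  have [|c _ Hc] := @EVT_max R (fun t => `|e t|) S (2 * S) S2.
    apply: continuous_in_subspaceT => t; rewrite inE/= in_itv/= => /andP[St _].
    by apply: continuous_comp; [exact: (HS _ St).1|exact: norm_continuous].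
  exists `|e c|; first exact: normr_ge0.
  by move=> t tS; apply: Hc; rewrite in_itv/=.
have bnd n : forall t, S <= t <= 2 ^+ n.+1 * S -> `|e t| <= M + 4 * d.
  elim: n => [t|n IH t /andP[St tS]].
    by rewrite expr1 => /HM H; rewrite (le_trans H)// lerDl mulr_ge0// ltW.
  have [t2|t2] := leP t (2 * S).
    by rewrite (le_trans (HM _ _)) ?St// lerDl mulr_ge0// ltW.
  have := IH (t / 2); have := (HS t St).2.
  have -> : S <= t / 2 by lra.
  have -> : t / 2 <= 2 ^+ n.+1 * S.
    by rewrite ler_pdivrMr// (le_trans tS)// [in leLHS]exprS; lra.
  move=> h1 /(_ isT) h2; lra.
have bnd' t : S <= t -> `|e t| <= M + 4 * d.
  move=> St.
  have [n Hn] : exists n, t <= 2 ^+ n.+1 * S.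
    exists (Num.truncn (t / S)); rewrite -ler_pdivrMr//.
    rewrite (@le_trans _ _ (Num.truncn (t / S)).+1%:R)//; first by rewrite ltW// truncnS_gt.
    by rewrite -natrX ler_nat ltnW// ltn_expl.
  by apply: (bnd n); rewrite St.
have dec n : forall t, 2 ^+ n * S <= t -> `|e t| <= (3 / 4) ^+ n * (M + 4 * d) + 4 * d.
  elim: n => [t|n IH t tS].
    rewrite expr0 mul1r => /bnd' H; rewrite expr0 mul1r (le_trans H)// lerDl mulr_ge0// ltW//.
  have St : S <= t.
    by rewrite (le_trans _ tS)// ler_peMl ?(ltW S0)// exprn_ege1// ler1n.
  have := IH (t / 2).
  have -> : 2 ^+ n * S <= t / 2.
    by rewrite ler_pdivlMr//; rewrite exprS in tS; lra.
  have := (HS t St).2; rewrite exprS; move=> h1 /(_ isT) h2; lra.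
have [n Hn] : exists n, (3 / 4) ^+ n * (M + 4 * d) <= eps / 2.
  have : (fun n => (3 / 4 : R) ^+ n * (M + 4 * d)) n @[n --> \oo] --> 0 * (M + 4 * d).
    apply: cvgM; last exact: cvg_cst.
    by apply: cvg_expr; rewrite ger0_norm; lra.
  rewrite mul0r => /cvgr0Pnorm_le/(_ (eps / 2)); rewrite divr_gt0// => /(_ isT)[n _ /(_ n)/=].
  by rewrite leqnn => /(_ isT) H; exists n; rewrite (le_trans (ler_norm _)).
near=> t.
have : 2 ^+ n * S <= t by near: t; apply: nbhs_pinfty_ge; rewrite num_real.
move=> /dec H; rewrite (le_trans H)//.
have : 4 * d = eps / 2 by rewrite /d; lra.
lra.
Unshelve. all: by end_near. Qed.

End UniformConvergence.

(** * Calculus of slowly varying functions and Karamata's theorem *)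

Section SlowVariation.
Context {R : realType}.
Implicit Types f g h : R -> R.

Lemma near_eq_cvg_pinfty f g (F : set_system R) :
  (\forall t \near +oo, f t = g t) ->
  f t @[t --> +oo] --> F -> g t @[t --> +oo] --> F.
Proof. by move=> fg; apply: cvg_trans; apply: near_eq_cvg. Qed.

Lemma cvgM_pinfty f g (a b : R) :
  f t @[t --> +oo] --> a -> g t @[t --> +oo] --> b ->
  f t * g t @[t --> +oo] --> a * b.
Proof. exact: cvgM. Qed.

(** A ratio [l > 1] reduces to [l^-1] by evaluating at [l * t] and inverting the quotient. *)
Lemma slow_of_lt1 f : (\forall t \near +oo, 0 < f t) ->
  (forall l : R, 0 < l < 1 -> f (l * t) / f t @[t --> +oo] --> (1 : R)) -> slow f.
Proof.
move=> fp H l l0; have [l1|l1|->] := ltgtP l 1; last 1 first.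
- apply: (near_eq_cvg_pinfty _ (cvg_cst (1 : R))).
  by near=> t; rewrite mul1r divff// gt_eqF//; near: t.
- by apply: H; rewrite l0.
have li : 0 < l^-1 < 1 by rewrite invr_gt0 l0 invf_lt1.
have := H _ li => {}H.
have {}H : f (l^-1 * (l * t)) / f (l * t) @[t --> +oo] --> (1 : R).
  by apply: cvg_comp H; exact: cvg_pinfty_scale.
have /cvgV := H; rewrite invr1 oner_eq0 => /(_ isT).
apply: cvg_trans; apply: near_eq_cvg; near=> t.
by rewrite /= mulrA mulVf ?gt_eqF// mul1r invf_div.
Unshelve. all: by end_near. Qed.

Lemma slowM f g : slow f -> slow g -> slow (fun t => f t * g t).
Proof.
move=> sf sg l l0; rewrite -[X in _ --> X]mulr1.
apply: cvg_trans (cvgM (sf l l0) (sg l l0)); apply: near_eq_cvg; near=> t.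
by rewrite /= invfM; ring.
Unshelve. all: by end_near. Qed.

Lemma slow_powR f (c : R) : (\forall t \near +oo, 0 < f t) -> slow f ->
  slow (fun t => f t `^ c).
Proof.
move=> fp sf l l0.
have H : expR (c * ln (f (l * t) / f t)) @[t --> +oo] --> expR (c * ln (1 : R)).
  apply: (@continuous_cvg _ _ _ _ _ _ (@expR R)); first exact: continuous_expR.
  apply: cvgMr; apply: (@continuous_cvg _ _ _ _ _ _ (@ln R)); last exact: sf.
  exact: continuous_ln.
rewrite ln1 mulr0 expR0 in H.
apply: cvg_trans H; apply: near_eq_cvg; near=> t.
have f1 : 0 < f t by near: t.
have f2 : 0 < f (l * t) by near: t; exact: (near_pinfty_scale l0 fp).
by rewrite /powR !gt_eqF// -expRB -mulrBr ln_div.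
Unshelve. all: by end_near. Qed.

Lemma slow_equiv f g (c : R) : c != 0 -> (\forall t \near +oo, g t != 0) ->
  f t / g t @[t --> +oo] --> c -> slow g -> slow f.
Proof.
move=> c0 g0 fg sg l l0.
have H1 : f (l * t) / g (l * t) @[t --> +oo] --> c.
  by apply: (cvg_comp _ _ (cvg_pinfty_scale l0) fg).
have : (f (l * t) / g (l * t)) * (f t / g t)^-1 * (g (l * t) / g t)
    @[t --> +oo] --> c * c^-1 * 1.
  by apply: cvgM; [apply: cvgM => //; exact: cvgV|exact: sg].
rewrite mulfV// mul1r; apply: near_eq_cvg_pinfty; near=> t.
have g1 : g t != 0 by near: t.
have g2 : g (l * t) != 0 by near: t; exact: (near_pinfty_scale l0 g0).
rewrite /= invf_div.
have [->|ft] := eqVneq (f t) 0; first by rewrite invr0 !mulr0 mul0r.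
by field; rewrite ft g1 g2.
Unshelve. all: by end_near. Qed.

Lemma derivable1_continuous f (t : R) : derivable f t 1 -> {for t, continuous f}.
Proof. by move=> d; exact/differentiable_continuous/derivable1_diffP. Qed.

Lemma near_is_derive_continuous f f' :
  (\forall t \near +oo, is_derive t (1 : R) f (f' t)) ->
  \forall t \near +oo, {for t, continuous f}.
Proof.
apply: filterS => t [df _].
exact: derivable1_continuous.
Qed.

Lemma mean_value f f' (a b : R) : a <= b ->
  (forall t, a <= t <= b -> is_derive t (1 : R) f (f' t)) ->
  exists2 c, a <= c <= b & f b - f a = f' c * (b - a).
Proof.
move=> ab df.
have [t|t|c cab E] := @MVT_segment R f f' a b ab.
- by rewrite in_itv/= => /andP[a1 b1]; apply: df; rewrite !ltW.
- apply: continuous_in_subspaceT t => t; rewrite inE/= in_itv/= => tab.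
  by have [H _] := df _ tab; exact: derivable1_continuous.
by exists c => //; move: cab; rewrite in_itv.
Qed.

(* The error [e t = F t / (t * f t) - 1] satisfies [|e t| <= 3/4 |e (t / 2)| + d]
   for large [t], so no integral representation of [f] is needed. *)
Lemma karamata f F :
  (\forall t \near +oo, is_derive t (1 : R) F (f t)) ->
  (\forall t \near +oo, 0 < f t) ->
  (\forall t \near +oo, {for t, continuous f}) -> slow f ->
  F t / (t * f t) @[t --> +oo] --> (1 : R).
Proof.
move=> dF fp cf sf.
have cF := near_is_derive_continuous dF.
pose e t := F t / (t * f t) - 1.
suff : e t @[t --> +oo] --> (0 : R).
  move=> /(cvgD (cvg_cst (1 : R))); rewrite addr0; apply: cvg_trans.
  by apply: near_eq_cvg; near=> t; rewrite /= /e addrC subrK.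
apply: halving_contraction.
  near=> t; apply: cvgB; last exact: cvg_cst.
  have t0 : 0 < t by [].
  apply: cvgM; first by near: t.
  apply: cvgV; first by rewrite mulf_neq0 ?gt_eqF//; near: t.
  by apply: cvgM; [exact: cvg_id|near: t].
move=> d d0.
(* With [p] and [q] the two ratios set below, [q >= 3/4] and the new error is at most
   [(|E0| / 2 + 3/2 * d1) / (3/4)], hence at most [3/4 * |E0| + 2 * d1]. *)
have [d1 [d10 d11 d1d]] : exists d1 : R, [/\ 0 < d1, d1 <= 1 / 4 & 2 * d1 <= d].
  exists (Num.min (1 / 4) (d / 2)); split.
  - by rewrite lt_min divr_gt0//= divr_gt0.
  - by rewrite ge_min lexx.
  by rewrite mulrC -ler_pdivlMr// ge_min lexx orbT.
have U := uniform_convergence fp cf sf d10.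
have [X X0 HX] : exists2 X : R, 0 < X & forall t, X <= t ->
   is_derive t (1 : R) F (f t) /\ 0 < f t /\
   forall u, t <= u <= 2 * t -> `|f u / f t - 1| <= d1.
  by apply: near_pinfty_ge; near=> t; split; [near: t|split; near: t].
near=> s.
have Xs2 : X <= s / 2 by rewrite ler_pdivlMr//.
have s0 : 0 < s by [].
have [xi /andP[x1 x2] E] : exists2 c, s / 2 <= c <= s & F s - F (s / 2) = f c * (s - s / 2).
  apply: mean_value => [|t /andP[t1 t2]]; first lra.
  by apply: (HX _ _).1; rewrite (le_trans Xs2).
have f1 : 0 < f (s / 2) by apply: (HX _ _).2.1.
have f2 : 0 < f s by apply: (HX _ _).2.1; lra.
have f3 : 0 < f xi by apply: (HX _ _).2.1; lra.
have := (HX _ Xs2).2.2 s; have -> : s / 2 <= s <= 2 * (s / 2) by apply/andP; split; lra.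
move=> /(_ isT); have := (HX _ Xs2).2.2 xi.
have -> : s / 2 <= xi <= 2 * (s / 2) by apply/andP; split; lra.
move=> /(_ isT).
rewrite /e.
(* Half of the error is inherited from [s / 2]; the other two terms measure only the variation of
   [f] on [[s / 2, s]]. *)
have -> : F s / (s * f s) - 1 = ((F (s / 2) / (s / 2 * f (s / 2)) - 1) / 2 +
   (1 - f s / f (s / 2)) + ((f xi / f (s / 2)) - 1) / 2) / (f s / f (s / 2)).
  have -> : F s = F (s / 2) + f xi * (s / 2) by move: E; lra.
  by field; rewrite !gt_eqF.
set p := f xi / _; set q := f s / _; set E0 := F _ / _ - 1.
move=> hp hq.
have q34 : 3 / 4 <= q by move: hq; rewrite ler_distl => /andP[+ _]; lra.
rewrite normrM normfV [`|q|]ger0_norm; last lra.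
rewrite ler_pdivrMr; last lra.
rewrite (le_trans (ler_normD _ _))// (le_trans (lerD (ler_normD _ _) (lexx _)))//.
have h2 (z : R) : `|z / 2| = `|z| / 2 by rewrite normrM [`|2^-1|]ger0_norm.
rewrite !h2.
rewrite [`|1 - q|]distrC.
have := normr_ge0 E0.
move: hp hq; set pp := `|p - 1|; set qq := `|q - 1|; set ee := `|E0|.
move=> hp hq he; have : (3 / 4 * ee + d) * (3 / 4) <= (3 / 4 * ee + d) * q.
  by rewrite ler_wpM2l//; lra.
lra.
Unshelve. all: by end_near. Qed.

(** The mean value theorem for [ln f] yields [(x * f' x / f x) * ((s - u) / x)] with [x >= c * s],
    so the second factor is at most [c^-1]. Uniformity in [u] is what permits a moving point such as
    the delayed argument. *)
Lemma log_derivative_uniform f f' :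
  (\forall t \near +oo, is_derive t (1 : R) f (f' t)) ->
  (\forall t \near +oo, 0 < f t) ->
  t * f' t / f t @[t --> +oo] --> (0 : R) ->
  forall c e : R, 0 < c -> 0 < e -> \forall s \near +oo,
    forall u, c * s <= u <= s -> `|f u / f s - 1| <= e.
Proof.
move=> df fp H c e c0 e0.
have [d d0 Hd] : exists2 d : R, 0 < d & forall v, `|v| <= d -> `|expR v - 1| <= e.
  have := @continuous_expR R 0; rewrite /continuous_at expR0.
  move=> /cvgrPdist_le/(_ _ e0)/nbhs_ballP[d /= d0 Hd].
  exists (d / 2); first by rewrite divr_gt0.
  move=> v vd; rewrite distrC; apply: Hd => /=.
  by rewrite /ball /= sub0r normrN (le_lt_trans vd)// ltr_pdivrMr// mulr_natr mulr2n ltrDl.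
have cd0 : 0 < c * d by rewrite mulr_gt0.
have [X X0 HX] : exists2 X : R, 0 < X & forall t, X <= t ->
   is_derive t (1 : R) f (f' t) /\ 0 < f t /\ `|t * f' t / f t| <= c * d.
  apply: near_pinfty_ge; near=> t; split; [near: t|split; near: t] => //.
  by move/cvgr0Pnorm_le : H; exact.
near=> s => u /andP[u1 u2].
have Xcs : X <= c * s by rewrite mulrC -ler_pdivrMr//.
have s0 : 0 < s by [].
have u0 : 0 < u by rewrite (lt_le_trans X0)// (le_trans Xcs).
have [x /andP[x1 x2] E] : exists2 x, u <= x <= s &
   (@ln R \o f) s - (@ln R \o f) u = ((f x)^-1 * f' x) * (s - u).
  apply: (@mean_value _ (fun x => (f x)^-1 * f' x)) => // x /andP[x1 x2].
  have [d1 [p1 _]] := HX x (le_trans Xcs (le_trans u1 x1)).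
  apply: (@is_derive1_comp R (@ln R) f) => //; exact: is_derive1_ln.
have Xx : X <= x by rewrite (le_trans Xcs)// (le_trans u1).
have [_ [fx Hx]] := HX _ Xx.
have fu : 0 < f u by apply: (HX _ _).2.1; exact: le_trans u1.
have fs : 0 < f s by apply: (HX _ _).2.1; rewrite (le_trans Xx).
have -> : f u / f s = expR (ln (f u) - ln (f s)).
  by rewrite expRB !lnK ?posrE.
apply: Hd; rewrite distrC; rewrite /= in E; rewrite E.
have x0 : 0 < x by exact: lt_le_trans Xx.
have -> : (f x)^-1 * f' x * (s - u) = (x * f' x / f x) * ((s - u) / x).
  by field; rewrite !gt_eqF.
rewrite normrM [X in _ * X]ger0_norm; last by rewrite divr_ge0 ?subr_ge0// ltW.
have sx : (s - u) / x <= c^-1.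
  by rewrite ler_pdivrMr// -ler_pdivrMl ?invr_gt0// invrK; nra.
rewrite (le_trans (ler_pM _ _ Hx sx))//.
  by rewrite divr_ge0 ?subr_ge0// ltW.
by rewrite mulrAC mulfV ?mul1r// gt_eqF.
Unshelve. all: by end_near. Qed.

Lemma log_derivative_slow f f' :
  (\forall t \near +oo, is_derive t (1 : R) f (f' t)) ->
  (\forall t \near +oo, 0 < f t) ->
  t * f' t / f t @[t --> +oo] --> (0 : R) -> slow f.
Proof.
move=> df fp H; apply: slow_of_lt1 => // l /andP[l0 l1].
apply/cvgrPdist_le => e e0.
have := log_derivative_uniform df fp H l0 e0.
apply: filterS2 (nbhs_pinfty_ge (num_real (0 : R))) => t t0 /(_ (l * t)).
rewrite lexx /= distrC; apply; rewrite ler_piMl// ltW//.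
Qed.

End SlowVariation.

(** * Limits of increasing functions and the tails [M - w] *)

Section Tail.
Context {R : realType}.

Lemma derive_gt0_increasing (w w' : R -> R) (X : R) :
  (forall t, X <= t -> is_derive t (1 : R) w (w' t)) ->
  (forall t, X <= t -> 0 < w' t) ->
  forall s t, X <= s -> s < t -> w s < w t.
Proof.
move=> dw w'0 s t Xs st.
have [|u /andP[u1 u2]|c /andP[c1 c2] E] := @mean_value R w w' s t.
- exact: ltW.
- by apply: dw; exact: le_trans u1.
by rewrite -subr_gt0 E mulr_gt0 ?subr_gt0// w'0// (le_trans Xs).
Qed.

Lemma increasing_cvg_or_pinfty (w w' : R -> R) :
  (\forall t \near +oo, is_derive t (1 : R) w (w' t)) ->
  (\forall t \near +oo, 0 < w' t) ->
  (exists M : R, w t @[t --> +oo] --> M) \/ w t @[t --> +oo] --> (+oo : set_system R).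
Proof.
move=> dw w'0.
have [X X0 HX] : exists2 X : R, 0 < X & forall t, X <= t ->
    is_derive t (1 : R) w (w' t) /\ 0 < w' t.
  by apply: near_pinfty_ge; apply: filterS2 dw w'0.
have mono : forall s t, X <= s -> s <= t -> w s <= w t.
  move=> s t Xs; rewrite le_eqVlt => /predU1P[->//|st].
  by apply/ltW/(@derive_gt0_increasing w w' X) => // u /HX [].
have [[M HM]|nb] := pselect (exists M, forall t, X <= t -> w t <= M).
  (* Freezing [w] to the left of [X] gives a function that is nondecreasing on the whole line. *)
  left; pose v t := w (Num.max X t).
  have nv : nondecreasing_fun v.
    by move=> s t st; apply: mono; [rewrite le_max lexx|rewrite le_max2].
  have bv : has_ubound (range v).
    by exists M => _ [t _ <-]; apply: HM; rewrite le_max lexx.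
  exists (sup (range v)); apply: near_eq_cvg_pinfty (nondecreasing_cvgr nv bv).
  by near=> t; rewrite /v max_r.
right; apply/cvgryPge => A.
have [T XT wT] : exists2 T, X <= T & A <= w T.
  apply: contrapT => H; apply: nb; exists A => t Xt.
  by rewrite leNgt; apply/negP => At; apply: H; exists t => //; exact: ltW.
near=> t; rewrite (le_trans wT)// mono//.
Unshelve. all: by end_near. Qed.

Lemma increasing_lt_limit (w w' : R -> R) (M : R) :
  (\forall t \near +oo, is_derive t (1 : R) w (w' t)) ->
  (\forall t \near +oo, 0 < w' t) ->
  w t @[t --> +oo] --> M -> \forall t \near +oo, w t < M.
Proof.
move=> dw w'0 wM.
have [X X0 HX] : exists2 X : R, 0 < X & forall t, X <= t ->
    is_derive t (1 : R) w (w' t) /\ 0 < w' t.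
  by apply: near_pinfty_ge; apply: filterS2 dw w'0.
have mono : forall s t, X <= s -> s < t -> w s < w t.
  by apply: (@derive_gt0_increasing w w' X) => u /HX [].
near=> t.
have Xt : X <= t by [].
rewrite (@lt_le_trans _ _ (w (t + 1)))//; first by apply: mono => //; rewrite ltrDl.
rewrite leNgt; apply/negP => Mw.
move/cvgr_lt : wM => /(_ _ Mw) [Y [_ HY]].
have := HY (Num.max (Y + 1) (t + 2)).
have -> : Y < Num.max (Y + 1) (t + 2) by rewrite lt_max ltrDl ltr01.
move=> /(_ isT); apply/negP; rewrite -leNgt; apply/ltW/mono; first lra.
by rewrite lt_max; apply/orP; right; lra.
Unshelve. all: by end_near. Qed.

(** Each block [[s, 2 * s]] contributes to [M - w] an amount comparable with [m s = s * w' s], and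
    [m] hardly changes from one block to the next. The tail holds arbitrarily many such blocks, so
    it dominates [m]. A single block is then negligible against the tail, which gives the limit for
    ratio 2; powers of 2 and monotonicity give the other ratios. *)
Lemma tail_slow (w w' : R -> R) (M : R) :
  (\forall t \near +oo, is_derive t (1 : R) w (w' t)) ->
  (\forall t \near +oo, 0 < w' t) ->
  (\forall t \near +oo, {for t, continuous w'}) ->
  slow (fun t => t * w' t) -> w t @[t --> +oo] --> M ->
  t * w' t / (M - w t) @[t --> +oo] --> (0 : R) /\ slow (fun t => M - w t).
Proof.
move=> dw w'0 cw' sm wM.
pose m t := t * w' t.
have mp : \forall t \near +oo, 0 < m t.
  by near=> t; rewrite mulr_gt0//; near: t.
have cm : \forall t \near +oo, {for t, continuous m}.
  by near=> t; apply: cvgM; [exact: cvg_id|near: t].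
have D0 := increasing_lt_limit dw w'0 wM.
have h2 : (0 : R) < 1 / 2 by lra.
have U : \forall s \near +oo, forall u, s <= u <= 2 * s -> `|m u / m s - 1| <= 1 / 2.
  exact: uniform_convergence.
have [X X0 HX] : exists2 X : R, 0 < X & forall t, X <= t ->
    [/\ is_derive t (1 : R) w (w' t), 0 < w' t, w t < M &
    forall u, t <= u <= 2 * t -> `|m u / m t - 1| <= 1 / 2].
  by apply: near_pinfty_ge; near=> t; split; near: t.
have mono : forall s t, X <= s -> s <= t -> w s <= w t.
  move=> s t Xs; rewrite le_eqVlt => /predU1P[->//|st].
  by apply/ltW/(@derive_gt0_increasing w w' X) => // u /HX [].
have incr s : X <= s -> m s / 4 <= w (2 * s) - w s <= 2 * m s.
  move=> Xs; have s0 : 0 < s by exact: lt_le_trans Xs.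
  have [|u /andP[u1 u2]|c /andP[c1 c2] E] := @mean_value R w w' s (2 * s); first lra.
    by have [] := HX u (le_trans Xs u1).
  have [_ _ _ /(_ c)] := HX _ Xs; rewrite c1 c2 => /(_ isT).
  have ms : 0 < m s by rewrite mulr_gt0//; have [] := HX _ Xs.
  have c0 : 0 < c by exact: lt_le_trans c1.
  (* Here [m c] lies between [m s / 2] and [3/2 * m s], and [s / c] between [1/2] and [1]; the
     factors [1/4] and [2] follow. *)
  have -> : w (2 * s) - w s = m c * (s / c).
    by rewrite E /m; field; rewrite gt_eqF.
  rewrite ler_distl => /andP[k1 k2].
  have {}k1 : m s / 2 <= m c.
    move: k1; rewrite ler_pdivlMr//; lra.
  have {}k2 : m c <= 3 / 2 * m s.
    move: k2; rewrite ler_pdivrMr//; lra.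
  have sc1 : s / c <= 1 by rewrite ler_pdivrMr// mul1r.
  have sc2 : 1 / 2 <= s / c by rewrite ler_pdivlMr//; lra.
  apply/andP; split.
    have -> : m s / 4 = m s / 2 * (1 / 2) by field.
    by rewrite ler_pM//; lra.
  have -> : 2 * m s = (2 * m s) * 1 by rewrite mulr1.
  by rewrite ler_pM//; lra.
have ratio2 : m (2 * t) / m t @[t --> +oo] --> (1 : R) by apply: sm.
(* Summing [incr] over dyadic blocks, along which [m] barely varies. *)
have big n : \forall s \near +oo, n%:R / 16 * m s <= M - w s.
  elim: n => [|n IH].
    by near=> s; rewrite !mul0r subr_ge0 ltW//; near: s.
  (* This tolerance gives [n * m (2 * s) >= (n - 1/2) * m s]. The block from [s] to [2 * s] adds
     [4/16], more than the missing [(1 + 1/2) / 16]. *)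
  have e0 : 0 < (n.+1%:R : R)^-1 / 2 by rewrite divr_gt0.
  near=> s.
  have Xs : X <= s by [].
  have I : n%:R / 16 * m (2 * s) <= M - w (2 * s).
    by near: s; apply: (near_pinfty_scale _ IH).
  have /andP[J _] := incr _ Xs.
  have ms : 0 < m s by near: s.
  have : `|1 - m (2 * s) / m s| <= (n.+1%:R : R)^-1 / 2.
    by near: s; move/cvgrPdist_le : ratio2; apply.
  rewrite distrC ler_distl => /andP[K _].
  have {}K : (1 - n.+1%:R^-1 / 2) * m s <= m (2 * s) by rewrite -ler_pdivlMr.
  have {}K : (n%:R - 1 / 2) * m s <= n%:R * m (2 * s).
    have n0 : (0 : R) <= n%:R by [].
    have N : n%:R * (n.+1%:R : R)^-1 <= 1 by rewrite ler_pdivrMr// mul1r ler_nat.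
    apply: le_trans (ler_wpM2l n0 K).
    rewrite [leRHS]mulrA; apply: ler_wpM2r; first exact: ltW.
    move: N; set z := _^-1; lra.
  rewrite -natr1; lra.
have lim0 : t * w' t / (M - w t) @[t --> +oo] --> (0 : R).
  apply/cvgr0Pnorm_le => e e0.
  have [n Hn] : exists n : nat, 16 / e <= n%:R.
    by exists (Num.truncn (16 / e)).+1; rewrite ltW// truncnS_gt.
  near=> s.
  have Xs : X <= s by [].
  have [_ w's wsM _] := HX _ Xs.
  have ms : 0 < m s by near: s.
  rewrite ger0_norm; last by rewrite divr_ge0 ?subr_ge0 ?ltW// -/(m s).
  rewrite ler_pdivrMr ?subr_gt0// -ler_pdivrMl//.
  have : n%:R / 16 * m s <= M - w s by near: s; exact: big.
  apply: le_trans; rewrite -[s * w' s]/(m s) ler_wpM2r ?(ltW ms)//.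
  by rewrite ler_pdivlMr// mulrC.
split => //.
have Dp : \forall t \near +oo, 0 < M - w t by apply: filterS D0 => t; rewrite subr_gt0.
have half : (M - w (2 * t)) / (M - w t) @[t --> +oo] --> (1 : R).
  apply/cvgrPdist_le => e e0.
  have e20 : 0 < e / 2 by rewrite divr_gt0.
  near=> s; have Xs : X <= s by [].
  have D : 0 < M - w s by near: s.
  have -> : 1 - (M - w (2 * s)) / (M - w s) = (w (2 * s) - w s) / (M - w s).
    by field; rewrite gt_eqF.
  have /andP[J1 J2] := incr _ Xs.
  have s2s : s <= 2 * s by lra.
  rewrite ger0_norm; last by rewrite divr_ge0 ?(ltW D)// subr_ge0 mono.
  rewrite ler_pdivrMr// (le_trans J2)//.
  have : `|m s / (M - w s)| <= e / 2 by near: s; move/cvgr0Pnorm_le : lim0; apply.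
  move=> /(le_trans (ler_norm _)); rewrite ler_pdivrMr//; lra.
have pow n : (M - w (2 ^+ n * t)) / (M - w t) @[t --> +oo] --> (1 : R).
  elim: n => [|n IH].
    apply: near_eq_cvg_pinfty (cvg_cst (1 : R)).
    by near=> t; rewrite expr0 mul1r divff// gt_eqF//; near: t.
  have t2 : (0 : R) < 2 ^+ n by rewrite exprn_gt0.
  have H : (M - w (2 * (2 ^+ n * t))) / (M - w (2 ^+ n * t)) @[t --> +oo] --> (1 : R).
    by apply: (cvg_comp _ _ (cvg_pinfty_scale t2) half).
  have := cvgM_pinfty H IH; rewrite mulr1; apply: near_eq_cvg_pinfty; near=> t.
  have D : 0 < M - w (2 ^+ n * t) by near: t; apply: (near_pinfty_scale t2 Dp).
  by rewrite /= mulrA mulfVK ?gt_eqF// mulrA exprS.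
apply: slow_of_lt1 => // l /andP[l0 l1].
(* Then [l * t <= t <= 2 ^+ n * (l * t)], and the decreasing tail at [t] is squeezed between its
   values at the two outer points. *)
have [n Hn] : exists n, l^-1 <= 2 ^+ n.
  exists (Num.truncn l^-1).+1.
  rewrite (@le_trans _ _ (Num.truncn l^-1).+1%:R)//; first by rewrite ltW// truncnS_gt.
  by rewrite -natrX ler_nat ltnW// ltn_expl.
have H : (M - w (2 ^+ n * (l * t))) / (M - w (l * t)) @[t --> +oo] --> (1 : R).
  by apply: (cvg_comp _ _ (cvg_pinfty_scale l0) (pow n)).
have Hi : ((M - w (2 ^+ n * (l * t))) / (M - w (l * t)))^-1 @[t --> +oo] --> (1 : R).
  by rewrite -[X in _ --> X]invr1; apply: cvgV.
apply: (@squeeze_cvgr _ _ _ _ (fun=> 1) _ _ _ _ (cvg_cst (1 : R)) Hi).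
near=> t.
have t0 : 0 < t by [].
have Xlt : X <= l * t by rewrite mulrC -ler_pdivrMr//.
have lt_t : l * t <= t by rewrite ler_piMl// ltW.
have Xt : X <= t by exact: le_trans lt_t.
have tn : t <= 2 ^+ n * (l * t).
  by rewrite mulrA ler_peMl ?(ltW t0)// -ler_pdivrMr// mul1r.
have [_ _ p1 _] := HX _ Xlt.
have [_ _ p2 _] := HX _ Xt.
have [_ _ p3 _] := HX _ (le_trans Xt tn).
rewrite ler_pdivlMr ?subr_gt0// mul1r lerB ?mono//= invf_div.
by rewrite ler_wpM2l ?subr_ge0 ?(ltW p1)// lef_pV2 ?posrE ?subr_gt0// lerB// mono.
Unshelve. all: by end_near. Qed.

End Tail.

(** * The half-linear equation in the variable s *)

Section PowR.
Context {R : realType}.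

Lemma powRV (z p : R) : 0 <= z -> z^-1 `^ p = (z `^ p)^-1.
Proof. by move=> z0; rewrite -(powR_inv1 z0) -powRrM mulN1r powRN. Qed.

Lemma continuous_powR (p z : R) : 0 < z -> {for z, continuous (@powR R ^~ p)}.
Proof.
move=> z0; apply: derivable1_continuous.
by have [] := is_derive1_powR p z0.
Qed.

Lemma cvg_powR (T : Type) (F : set_system T) {FF : Filter F} (f : T -> R) (p z : R) :
  0 < z -> f t @[t --> F] --> z -> f t `^ p @[t --> F] --> z `^ p.
Proof.
move=> z0 fz; apply: (@continuous_cvg _ _ _ _ _ _ (@powR R ^~ p)) => //.
exact: continuous_powR.
Qed.

Lemma cvg_powR_pinfty (f : R -> R) (p z : R) : 0 < z ->
  f t @[t --> +oo] --> z -> f t `^ p @[t --> +oo] --> z `^ p.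
Proof. exact: cvg_powR. Qed.

End PowR.

(* The equation after the change of variable: [x] is the solution, [v = x'],
   [w = v `^ p] its quasiderivative with [p = alpha - 1], [theta] the delay. *)
Section HalfLinear.
Context {R : realType} (p c : R) (x w P theta f : R -> R).
Let v t := w t `^ p^-1.
Let w' t := P t * x (theta t) `^ p.
Let Q t := (f t * t) `^ p * P t.
(** With [p = alpha - 1] this is [t ^ alpha * P t], the slowly varying factor of the coefficient. *)
Let l t := t * t `^ p * P t.
Context (p0 : 0 < p) (c0 : 0 < c)
  (dx : \forall t \near +oo, is_derive t (1 : R) x (v t))
  (dw : \forall t \near +oo, is_derive t (1 : R) w (w' t))
  (dtheta : \forall t \near +oo, is_derive t (1 : R) theta (f t))
  (x0 : \forall t \near +oo, 0 < x t)
  (w0 : \forall t \near +oo, 0 < w t)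
  (P0 : \forall t \near +oo, 0 < P t)
  (f0 : \forall t \near +oo, 0 < f t)
  (cP : \forall t \near +oo, {for t, continuous P})
  (cf : \forall t \near +oo, {for t, continuous f})
  (theta_le : \forall t \near +oo, theta t <= t)
  (theta_ge : \forall t \near +oo, c * t <= theta t)
  (sf : slow f) (sl : slow l) (l0 : l t @[t --> +oo] --> (0 : R)).

Lemma cvg_delay : theta t @[t --> +oo] --> (+oo : set_system R).
Proof. exact: (ger_cvgy theta_ge (cvg_pinfty_scale c0)). Qed.

Lemma near_delay (A : R -> Prop) : (\forall t \near +oo, A t) ->
  \forall t \near +oo, A (theta t).
Proof. by move=> H; exact: cvg_delay. Qed.

Lemma near_v_gt0 : \forall t \near +oo, 0 < v t.
Proof. by apply: filterS w0 => t; exact: powR_gt0. Qed.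

Lemma near_w'_gt0 : \forall t \near +oo, 0 < w' t.
Proof.
near=> t; rewrite mulr_gt0//; first by near: t.
by rewrite powR_gt0//; near: t; exact: (near_delay x0).
Unshelve. all: by end_near. Qed.

Lemma near_w'_continuous : \forall t \near +oo, {for t, continuous w'}.
Proof.
have cx := near_is_derive_continuous dx.
have ct := near_is_derive_continuous dtheta.
near=> t; apply: cvgM; first by near: t.
apply: cvg_powR; first by near: t; exact: (near_delay x0).
have ct0 : {for t, continuous theta} by near: t.
have cx0 : {for theta t, continuous x} by near: t; exact: (near_delay cx).
exact: (continuous_comp ct0 cx0).
Unshelve. all: by end_near. Qed.

Lemma near_derive_v : \forall t \near +oo,
  is_derive t (1 : R) v (p^-1 * v t * (w' t / w t)).
Proof.
near=> t.
have wt : 0 < w t by near: t.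
have dwt : is_derive t (1 : R) w (w' t) by near: t.
have := @is_derive1_comp R (@powR R ^~ p^-1) w t _ _ (is_derive1_powR p^-1 wt) dwt.
suff -> : p^-1 * w t `^ (p^-1 - 1) * w' t = p^-1 * v t * (w' t / w t) by [].
rewrite powRB; last by rewrite (gt_eqF wt) implybT.
by rewrite powRr1 ?ltW// /v; field; rewrite !gt_eqF.
Unshelve. all: by end_near. Qed.

Lemma powRv t : 0 < w t -> v t `^ p = w t.
Proof. by move=> wt; rewrite /v -powRrM mulVf ?gt_eqF// powRr1// ltW. Qed.

(** As [w] increases, so does [v], and the increment of [x] from [X] to [t] is at most [t * v t].
    The initial value [x X] is at most [t * v X] once [t >= x X / v X], which accounts for the
    factor 2. This crude bound is available before any slow variation is known. *)
Lemma near_x_le : \forall t \near +oo, x t <= 2 * (t * v t).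
Proof.
have [X X0 HX] : exists2 X : R, 0 < X & forall t, X <= t ->
    [/\ is_derive t (1 : R) w (w' t), 0 < w' t, is_derive t (1 : R) x (v t) & 0 < w t].
  have w'0 := near_w'_gt0.
  by apply: near_pinfty_ge; near=> t; split; near: t.
have mono : forall s t, X <= s -> s <= t -> v s <= v t.
  move=> s t Xs st; rewrite /v ge0_ler_powR ?nnegrE ?invr_ge0 ?(ltW p0)//.
  - by have [_ _ _ /ltW] := HX _ Xs.
  - by have [_ _ _ /ltW] := HX _ (le_trans Xs st).
  move: st; rewrite le_eqVlt => /predU1P[->//|st].
  by apply/ltW/(@derive_gt0_increasing _ w w' X) => // u /HX [].
have vX : 0 < v X by apply: powR_gt0; have [] := HX _ (lexx X).
near=> t.
have Xt : X <= t by [].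
have [|u /andP[u1 u2]|d /andP[d1 d2] E] := @mean_value R x v X t; first by [].
  by have [] := HX _ u1.
have t0 : 0 < t by [].
have tX : x X / v X <= t by [].
have H1 : x X <= t * v t.
  rewrite ler_pdivrMr// in tX; rewrite (le_trans tX)// ler_wpM2l ?(ltW t0)// mono//.
have H2 : v d * (t - X) <= v t * t.
  rewrite ler_pM ?subr_ge0 ?powR_ge0 ?mono// lerBlDr lerDl ltW//.
lra.
Unshelve. all: by end_near. Qed.

(** As [x] increases and [theta t <= t], the delayed value is at most [x t <= 2 * (t * v t)]. Since
    [v ^ p = w], the quotient is bounded by [2 ^ p * l t]. *)
Lemma cvg_log_derivative_w : t * w' t / w t @[t --> +oo] --> (0 : R).
Proof.
have xle := near_x_le.
have H : 2 `^ p * l t @[t --> +oo] --> (0 : R).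
  by rewrite -[X in _ --> X](mulr0 (2 `^ p)); apply: cvgM => //; exact: cvg_cst.
apply: (@squeeze_cvgr _ _ _ _ (fun=> 0) _ _ _ _ (cvg_cst (0 : R)) H).
have v0 := near_v_gt0; have w'0 := near_w'_gt0.
have xth := near_delay x0.
have [X X0 HX] : exists2 X : R, 0 < X & forall t, X <= t ->
    is_derive t (1 : R) x (v t) /\ 0 < v t.
  by apply: near_pinfty_ge; near=> t; split; near: t.
near=> t.
have t0 : 0 < t by [].
have wt : 0 < w t by near: t.
have vt : 0 < v t by near: t.
have Pt : 0 < P t by near: t.
have w't : 0 < w' t by near: t.
have tw0 : 0 <= t * w' t by apply: mulr_ge0; exact: ltW.
rewrite (divr_ge0 tw0 (ltW wt)) /=.
rewrite ler_pdivrMr//.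
have -> : 2 `^ p * l t * w t = t * (P t * (2 * (t * v t)) `^ p).
  rewrite powRM ?mulr_ge0 ?(ltW t0) ?(ltW vt)//.
  by rewrite powRM ?(ltW t0) ?(ltW vt)// powRv// /l; ring.
apply: ler_wpM2l; first exact: ltW.
apply: ler_wpM2l; first exact: ltW.
have xth0 : 0 < x (theta t) by near: t.
have xt0 : 0 < x t by near: t.
rewrite ge0_ler_powR ?nnegrE ?(ltW p0) ?(ltW xth0) ?mulr_ge0 ?(ltW t0) ?(ltW vt)//.
have xle_t : x t <= 2 * (t * v t) by near: t.
apply: le_trans xle_t.
have Xth : X <= theta t.
  by near: t; exact: (near_delay (nbhs_pinfty_ge (num_real X))).
have tht : theta t <= t by near: t.
move: tht; rewrite le_eqVlt => /predU1P[->//|tht].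
by apply/ltW/(@derive_gt0_increasing _ x v X) => // u /HX [].
Unshelve. all: by end_near. Qed.

Lemma slow_w : slow w.
Proof. exact: (log_derivative_slow dw w0 cvg_log_derivative_w). Qed.

Lemma slow_v : slow v.
Proof. exact: slow_powR w0 slow_w. Qed.

Lemma near_v_continuous : \forall t \near +oo, {for t, continuous v}.
Proof. exact: near_is_derive_continuous near_derive_v. Qed.

Lemma cvg_x_div : x t / (t * v t) @[t --> +oo] --> (1 : R).
Proof. exact: karamata dx near_v_gt0 near_v_continuous slow_v. Qed.

(** The point [theta t] stays in [[c * t, t]] but need not be a fixed multiple of [t], hence the
    appeal to the uniform estimate for [w]. *)
Lemma cvg_delay_v : v (theta t) / v t @[t --> +oo] --> (1 : R).
Proof.
have H : w (theta t) / w t @[t --> +oo] --> (1 : R).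
  apply/cvgrPdist_le => e e0.
  have := log_derivative_uniform dw w0 cvg_log_derivative_w c0 e0.
  apply: filterS3 theta_le theta_ge => t t1 t2 /(_ (theta t)).
  by rewrite t1 t2 distrC; apply.
have := cvg_powR_pinfty (p := p^-1) ltr01 H; rewrite powR1.
have wth := near_delay w0.
apply: near_eq_cvg_pinfty; near=> t.
have wt : 0 < w t by near: t.
have wtht : 0 < w (theta t) by near: t.
by rewrite powRM ?invr_ge0 ?(ltW wt) ?(ltW wtht)// powRV// ltW.
Unshelve. all: by end_near. Qed.

Lemma cvg_delay_x : x (theta t) / (f t * t * v t) @[t --> +oo] --> (1 : R).
Proof.
have H1 : x (theta t) / (theta t * v (theta t)) @[t --> +oo] --> (1 : R).
  exact: (cvg_comp _ _ cvg_delay cvg_x_div).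
have H2 := karamata dtheta f0 cf sf.
have := cvgM_pinfty (cvgM_pinfty H1 cvg_delay_v) H2; rewrite !mulr1.
have vth := near_delay near_v_gt0; have v0 := near_v_gt0.
have th0 := near_delay (nbhs_pinfty_gt (num_real (0 : R))).
apply: near_eq_cvg_pinfty; near=> t.
have t0 : 0 < t by [].
have vt : 0 < v t by near: t.
have tht : 0 < theta t by near: t.
have vtht : 0 < v (theta t) by near: t.
have ft : 0 < f t by near: t.
by rewrite /=; field; rewrite !gt_eqF.
Unshelve. all: by end_near. Qed.

Lemma near_Q_gt0 : \forall t \near +oo, 0 < Q t.
Proof.
near=> t; rewrite mulr_gt0//; last by near: t.
by rewrite powR_gt0// mulr_gt0//; near: t.
Unshelve. all: by end_near. Qed.

(** This is the [p]-th power of [cvg_delay_x], because [v ^ p = w]. *)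
Lemma cvg_w'_div : w' t / (w t * Q t) @[t --> +oo] --> (1 : R).
Proof.
have := cvg_powR_pinfty (p := p) ltr01 cvg_delay_x; rewrite powR1.
have v0 := near_v_gt0; have xth := near_delay x0.
apply: near_eq_cvg_pinfty; near=> t.
have t0 : 0 < t by [].
have vt : 0 < v t by near: t.
have ft : 0 < f t by near: t.
have wt : 0 < w t by near: t.
have Pt : 0 < P t by near: t.
have xtht : 0 < x (theta t) by near: t.
have ftt : 0 < f t * t by rewrite mulr_gt0.
have E : ((f t * t * v t)^-1) `^ p = ((f t * t) `^ p * w t)^-1.
  have ftv : 0 <= f t * t * v t by rewrite ltW// mulr_gt0.
  by rewrite powRV// powRM ?(ltW ftt) ?(ltW vt)// powRv.
rewrite powRM ?(ltW xtht)//; last by rewrite invr_ge0 ltW// mulr_gt0.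
rewrite E /w' /Q; field.
by rewrite !gt_eqF// powR_gt0.
Unshelve. all: by end_near. Qed.

(** Splitting the power gives [t * Q t = f t ^ p * l t], a product of two slowly varying
    functions. *)
Lemma slow_tQ : slow (fun t => t * Q t).
Proof.
have := slowM (slow_powR p f0 sf) sl.
apply: (@slow_equiv R _ _ 1); first exact: oner_neq0.
  near=> t; rewrite mulf_neq0// ?gt_eqF//.
    by apply: powR_gt0; near: t.
  rewrite /l mulr_gt0//; last by near: t.
  by rewrite mulr_gt0// powR_gt0.
apply: (near_eq_cvg_pinfty _ (cvg_cst (1 : R))); near=> t.
have ft : 0 < f t by near: t.
have t0 : 0 < t by [].
have Pt : 0 < P t by near: t.
rewrite /Q /l powRM ?(ltW ft) ?(ltW t0)//.
by field; rewrite !gt_eqF// powR_gt0.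
Unshelve. all: by end_near. Qed.

(** The delayed solution inside [w'] is avoided by passing to the equivalent [w t * (t * Q t)]. *)
Lemma slow_tw' : slow (fun t => t * w' t).
Proof.
have := slowM slow_w slow_tQ.
have Q0 := near_Q_gt0.
apply: (@slow_equiv R _ _ 1); first exact: oner_neq0.
  near=> t; have wt : 0 < w t by near: t.
  have Qt : 0 < Q t by near: t.
  have t0 : 0 < t by [].
  by rewrite gt_eqF// mulr_gt0// mulr_gt0.
apply: near_eq_cvg_pinfty cvg_w'_div; near=> t.
have t0 : 0 < t by [].
have wt : 0 < w t by near: t.
have Qt : 0 < Q t by near: t.
by field; rewrite !gt_eqF.
Unshelve. all: by end_near. Qed.

(** The derivative [k t = t * v' t] of [t * v t - x t] is equivalent to [p^-1 * v t * (t * Q t)],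
    hence slowly varying. Karamata's theorem holds for every primitive, so no constant of
    integration has to be determined. The denominator [x] enters through [x t] being equivalent to
    [t * v t]. *)
Lemma cvg_index_remainder :
  (t * v t - x t) / (x t * (p^-1 * (t * Q t))) @[t --> +oo] --> (1 : R).
Proof.
pose k t := t * (p^-1 * v t * (w' t / w t)).
have v0 := near_v_gt0; have Q0 := near_Q_gt0; have w'0 := near_w'_gt0.
have sk : slow k.
  have := slowM slow_v slow_tQ.
  apply: (@slow_equiv R _ _ p^-1); first by rewrite invr_eq0 gt_eqF.
    near=> t; have vt : 0 < v t by near: t.
    have Qt : 0 < Q t by near: t.
    have t0 : 0 < t by [].
  by rewrite gt_eqF// mulr_gt0// mulr_gt0.
  rewrite -[X in _ --> X]mulr1.
  apply: near_eq_cvg_pinfty (cvgM_pinfty (cvg_cst p^-1) cvg_w'_div); near=> t.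
  have t0 : 0 < t by [].
  have wt : 0 < w t by near: t.
  have vt : 0 < v t by near: t.
  have Qt : 0 < Q t by near: t.
  by rewrite /k /=; field; rewrite !gt_eqF.
have kp : \forall t \near +oo, 0 < k t.
  near=> t.
  have wt : 0 < w t by near: t.
  have vt : 0 < v t by near: t.
  have w't : 0 < w' t by near: t.
  have t0 : 0 < t by [].
  rewrite /k mulr_gt0// mulr_gt0//; last exact: divr_gt0.
  by rewrite mulr_gt0// invr_gt0.
have ck : \forall t \near +oo, {for t, continuous k}.
  have cv := near_v_continuous; have cw' := near_w'_continuous.
  have cw := near_is_derive_continuous dw.
  near=> t; apply: cvgM; first exact: cvg_id.
  apply: cvgM; first by apply: cvgM; [exact: cvg_cst|near: t].
  apply: cvgM; first by near: t.
  by apply: cvgV; [rewrite gt_eqF//; near: t|near: t].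
have dH : \forall t \near +oo, is_derive t (1 : R) (fun t => t * v t - x t) (k t).
  have dv := near_derive_v.
  near=> t.
  have dvt : is_derive t (1 : R) v (p^-1 * v t * (w' t / w t)) by near: t.
  have dxt : is_derive t (1 : R) x (v t) by near: t.
  have := is_deriveB (is_deriveM (is_derive_id t (1 : R)) dvt) dxt.
  suff -> : k t = t *: (p^-1 * v t * (w' t / w t)) + v t *: 1 - v t by [].
  by rewrite /k /GRing.scale /= mulr1 addrK.
have K := karamata dH kp ck sk.
have xv1 : (x t / (t * v t))^-1 @[t --> +oo] --> (1 : R).
  by rewrite -[X in _ --> X]invr1; apply: cvgV => //; exact: cvg_x_div.
have := cvgM_pinfty (cvgM_pinfty K cvg_w'_div) xv1; rewrite !mulr1.
apply: near_eq_cvg_pinfty; near=> t.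
have t0 : 0 < t by [].
have wt : 0 < w t by near: t.
have vt : 0 < v t by near: t.
have w't : 0 < w' t by near: t.
have Qt : 0 < Q t by near: t.
have xt : 0 < x t by near: t.
by rewrite /= /k; field; rewrite !gt_eqF.
Unshelve. all: by end_near. Qed.

(** [tail_slow] compares [M - w] with [t * w' t]. Replacing [w'] by [w * Q] leaves a factor [w],
    which is harmless because its limit [M] is positive. *)
Lemma cvg_tail (M : R) : w t @[t --> +oo] --> M ->
  t * Q t / (M - w t) @[t --> +oo] --> (0 : R) /\ slow (fun t => M - w t).
Proof.
move=> wM.
have w'0 := near_w'_gt0; have Q0 := near_Q_gt0.
have [T1 T2] := tail_slow dw w'0 near_w'_continuous slow_tw' wM.
split => //.
have [X X0 HX] : exists2 X : R, 0 < X & forall t, X <= t ->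
    [/\ is_derive t (1 : R) w (w' t), 0 < w' t & 0 < w t].
  by apply: near_pinfty_ge; near=> t; split; near: t.
have M0 : 0 < M.
  have wX : 0 < w X by have [] := HX _ (lexx X).
  rewrite (lt_le_trans wX)// leNgt; apply/negP => MX.
  have [Y [_ HY]] : \forall t \near +oo, w t < w X by move/cvgr_lt: wM; exact.
  have := HY (Num.max (Y + 1) (X + 1)); rewrite lt_max ltrDl ltr01 => /(_ isT).
  apply/negP; rewrite -leNgt; apply/ltW/(@derive_gt0_increasing _ w w' X) => //.
  - by move=> u /HX[].
  - by move=> u /HX[].
  by rewrite lt_max ltrDl ltr01 orbT.
have H1 : (w' t / (w t * Q t))^-1 @[t --> +oo] --> (1 : R).
  by rewrite -[X in _ --> X]invr1; apply: cvgV => //; exact: cvg_w'_div.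
have H2 : (w t)^-1 @[t --> +oo] --> M^-1 by apply: cvgV => //; rewrite gt_eqF.
have := cvgM_pinfty (cvgM_pinfty T1 H1) H2; rewrite !mul0r; apply: near_eq_cvg_pinfty.
have Mw := increasing_lt_limit dw w'0 wM.
near=> t.
have w't : 0 < w' t by near: t.
have wt : 0 < w t by near: t.
have Qt : 0 < Q t by near: t.
have Mwt : 0 < M - w t by rewrite subr_gt0; near: t.
by rewrite /=; field; rewrite !gt_eqF.
Unshelve. all: by end_near. Qed.

Lemma cvg_x_pinfty : x t @[t --> +oo] --> (+oo : set_system R).
Proof.
have [X X0 HX] : exists2 X : R, 0 < X & forall t, X <= t ->
    [/\ is_derive t (1 : R) w (w' t), 0 < w' t, is_derive t (1 : R) x (v t) &
     0 < w t /\ 0 < x t].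
  have w'0 := near_w'_gt0.
  by apply: near_pinfty_ge; near=> t; split; [near: t..|split; near: t].
have vX : 0 < v X by apply: powR_gt0; have [_ _ _ []] := HX _ (lexx X).
have mono : forall t, X <= t -> v X <= v t.
  move=> t Xt; rewrite /v ge0_ler_powR ?nnegrE ?invr_ge0 ?(ltW p0)//.
  - by have [_ _ _ [/ltW]] := HX _ (lexx X).
  - by have [_ _ _ [/ltW]] := HX _ Xt.
  move: Xt; rewrite le_eqVlt => /predU1P[->//|Xt].
  by apply/ltW/(@derive_gt0_increasing _ w w' X) => // u /HX [].
have H : v X * (t - X) @[t --> +oo] --> (+oo : set_system R).
  by apply: gt0_cvgMry => //; exact: cvg_addrr.
apply: ger_cvgy H; near=> t.
have Xt : X <= t by [].
have [|u /andP[u1 u2]|d /andP[d1 d2] E] := @mean_value R x v X t; first by [].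
  by have [] := HX _ u1.
have [_ _ _ [_ xX]] := HX _ (lexx X).
have -> : x t = x X + v d * (t - X) by rewrite -E addrC subrK.
by rewrite ler_wpDl ?(ltW xX)// ler_wpM2r ?subr_ge0// mono.
Unshelve. all: by end_near. Qed.

Lemma half_linear_asymptotics :
  [/\ x t @[t --> +oo] --> (+oo : set_system R),
      x t / (t * v t) @[t --> +oo] --> (1 : R),
      w' t / (w t * Q t) @[t --> +oo] --> (1 : R),
      (t * v t - x t) / (x t * (p^-1 * (t * Q t))) @[t --> +oo] --> (1 : R) &
      forall M : R, w t @[t --> +oo] --> M ->
        t * Q t / (M - w t) @[t --> +oo] --> (0 : R) /\ slow (fun t => M - w t)].
Proof.
by split; [exact: cvg_x_pinfty|exact: cvg_x_div|exact: cvg_w'_div|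
  exact: cvg_index_remainder|exact: cvg_tail].
Qed.

End HalfLinear.

(** * The change of variable *)

Section Primitive.
Context {R : realType}.
Implicit Types (a t s u : R).

Lemma within_cy_continuous_at a (f : R -> R) t : {within `[a, +oo[, continuous f} ->
  a < t -> {for t, continuous f}.
Proof. by move=> /continuous_within_itvcyP[cf _] at'; apply: cf; rewrite in_itv/= at'. Qed.

Lemma within_cy_segment a (f : R -> R) u t : {within `[a, +oo[, continuous f} ->
  a <= u -> {within `[u, t], continuous f}.
Proof.
move=> cf au; apply: continuous_subspaceW cf => z /=.
by rewrite !in_itv/= andbT => /andP[uz _]; exact: le_trans uz.
Qed.

Lemma within_cy_integrable a (f : R -> R) u t : {within `[a, +oo[, continuous f} ->
  a <= u -> (leb R).-integrable `[u, t] (fun s => (f s)%:E).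
Proof.
move=> cf au; apply: continuous_compact_integrable; first exact: segment_compact.
exact: within_cy_segment cf au.
Qed.

Lemma within_cy_measurable a (f : R -> R) : {within `[a, +oo[, continuous f} ->
  measurable_fun (`[a, +oo[ : set R) f.
Proof. by move=> cf; apply: subspace_continuous_measurable_fun. Qed.

Context (a : R) (rho : R -> R).
(** Later [rho] is [r ^ (1 - beta)], and [G], [g] are [R_D], [R_Dinv]. *)
Let G t := \int[leb R]_(s in `[a, t]) rho s.
Let g : R -> R := pinv `[a, +oo[ G.
Context (rho_cont : {within `[a, +oo[, continuous rho})
  (rho_gt0 : forall t, a <= t -> 0 < rho t)
  (rho_int : (\int[leb R]_(s in `[a, +oo[) (rho s)%:E = +oo)%E).

Lemma primitive_is_derive t : a < t -> is_derive t (1 : R) G (rho t).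
Proof.
move=> at'.
have [d1 d2] := @continuous_FTC1_closed R rho a t (t + 1) (ltr_pwDr ltr01 (lexx t))
  (within_cy_integrable (t + 1) rho_cont (lexx a)) at' (within_cy_continuous_at rho_cont at').
by apply: DeriveDef; [exact: d1|rewrite -derive1E d2].
Qed.

Lemma primitive0 : G a = 0.
Proof. by rewrite /G set_itv1 Rintegral_set1. Qed.

Lemma primitive_continuous t u : a <= t -> {within `[t, u], continuous G}.
Proof.
move=> ta; have [ut|tu] := ltP u t.
  rewrite set_itv_ge; last by rewrite bnd_simp -ltNge.
  exact: continuous_subspace0.
have H := @parameterized_integral_continuous R a u rho (le_trans ta tu)
  (within_cy_integrable u rho_cont (lexx a)).
apply: continuous_subspaceW H => z /=.
by rewrite !in_itv/= => /andP[tz ->]; rewrite (le_trans ta).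
Qed.

Lemma primitive_lt s t : a <= s -> s < t -> G s < G t.
Proof.
move=> as' st.
have [|c] := @MVT R G rho s t st _ (@primitive_continuous s t as').
  move=> z; rewrite in_itv/= => /andP[sz _]; apply: primitive_is_derive.
  exact: le_lt_trans sz.
rewrite in_itv/= => /andP[sc _] E.
by rewrite -subr_gt0 E mulr_gt0 ?subr_gt0// rho_gt0// (le_trans as')// ltW.
Qed.

Lemma primitive_le s t : a <= s -> s <= t -> G s <= G t.
Proof.
by move=> as'; rewrite le_eqVlt => /predU1P[->//|st]; apply/ltW/primitive_lt.
Qed.

Lemma primitive_gt0 t : a < t -> 0 < G t.
Proof. by move=> at'; rewrite -primitive0 primitive_lt. Qed.

(** A finite limit [M] of [G] would give the integral of [rho] over the ray the finite value
    [M - G a], against [rho_int]. *)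
Lemma primitive_cvg : G t @[t --> +oo] --> (+oo : set_system R).
Proof.
have dG : \forall t \near +oo, is_derive t (1 : R) G (rho t).
  apply: filterS (nbhs_pinfty_gt (num_real a)) => t.
  exact: primitive_is_derive.
have rp : \forall t \near +oo, 0 < rho t by near=> t; apply: rho_gt0.
have [[M GM]|//] := increasing_cvg_or_pinfty dG rp.
have Ga : G x @[x --> a^'+] --> G a.
  have a1 : a < a + 1 by rewrite ltrDl.
  by have /(continuous_within_itvP _ a1)[] := @primitive_continuous a (a + 1) (lexx a).
have H := @ge0_continuous_FTC2y R rho G a M (fun t h => ltW (rho_gt0 h)) rho_cont GM
   _ Ga _.
move: rho_int; rewrite H -?EFinB//.
- by move=> t /primitive_is_derive[].
- move=> t; rewrite in_itv/= andbT => /primitive_is_derive[d1 d2].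
  by rewrite derive1E d2.
Unshelve. all: by end_near. Qed.

Lemma primitive_surj s : 0 <= s -> exists2 t, a <= t & G t = s.
Proof.
move=> s0.
have [T aT sT] : exists2 T, a <= T & s <= G T.
  near (pinfty_nbhs R) => T; exists T => //.
  by near: T; move: primitive_cvg => /cvgryPge; exact.
have [|c] := @IVT R G a T s aT (@primitive_continuous a T (lexx a)).
  by rewrite primitive0 ge_min s0 /= le_max sT orbT.
by rewrite in_itv/= => /andP[ac _] <-; exists c.
Unshelve. all: by end_near. Qed.

Lemma primitive_inj : {in `[a, +oo[%classic &, injective G}.
Proof.
move=> s t; rewrite !inE/= !in_itv/= !andbT => as' at' E.
by case: (ltgtP s t) => // [/(primitive_lt as')|/(primitive_lt at')]; rewrite E ltxx.
Qed.

Lemma primitive_invK t : a <= t -> g (G t) = t.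
Proof.
move=> at'; apply: (pinvKV (fun=> point) primitive_inj).
by rewrite inE/= in_itv/= at'.
Qed.

Lemma primitive_inv_ge s : 0 <= s -> a <= g s.
Proof. by move=> /primitive_surj[t at' <-]; rewrite primitive_invK. Qed.

Lemma primitiveK s : 0 <= s -> G (g s) = s.
Proof. by move=> /primitive_surj[t at' <-]; rewrite primitive_invK. Qed.

Lemma primitive_inv_gt s : 0 < s -> a < g s.
Proof.
move=> s0; rewrite lt_neqAle primitive_inv_ge ?ltW// andbT.
apply/negP => /eqP ags; move: (s0).
by rewrite -(primitiveK (ltW s0)) -ags primitive0 ltxx.
Qed.

Lemma primitive_inv_is_derive s : 0 < s -> is_derive s (1 : R) g (rho (g s))^-1.
Proof.
move=> s0; have ag := primitive_inv_gt s0.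
rewrite -{1}(primitiveK (ltW s0)).
apply: (@is_derive_inverse R G g (rho (g s)) (g s)).
- near=> t; apply: primitive_invK; apply/ltW; near: t; exact: lt_nbhsr.
- near=> t; have [d _] : is_derive t (1 : R) G (rho t).
    by apply: primitive_is_derive; near: t; exact: lt_nbhsr.
  exact: derivable1_continuous.
- exact: primitive_is_derive.
- by rewrite gt_eqF// rho_gt0// ltW.
Unshelve. all: by end_near. Qed.

Lemma primitive_inv_cvg : g s @[s --> +oo] --> (+oo : set_system R).
Proof.
apply/cvgryPge => A; near=> s.
have s0 : 0 <= s by [].
rewrite leNgt; apply/negP => gA.
have : G (g s) < G A by apply: primitive_lt => //; exact: primitive_inv_ge.
rewrite primitiveK//; apply/negP; rewrite -leNgt.
by near: s; apply: nbhs_pinfty_ge; rewrite num_real.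
Unshelve. all: by end_near. Qed.

End Primitive.

(** * Derivatives relative to an interval *)

Section Derivative_on.
Context {R : realType}.

(** A point beyond [i0] is interior to [I], so the relative limit is a full one; the substitution
    [s = h + t] turns it into the usual difference quotient. *)
Lemma derivative_on_is_derive (I : set R) (f f' : R -> R) (i0 t : R) :
  derivative_on I f f' -> (forall s, i0 <= s -> I s) -> i0 < t ->
  is_derive t (1 : R) f (f' t).
Proof.
move=> df I0 i0t; have It : I t by apply/I0/ltW.
have It' : nbhs t I.
  have := lt_nbhsr i0t; apply: filterS => s /= /ltW; exact: I0.
have H : (f s - f t) / (s - t) @[s --> t^'] --> f' t.
  apply: cvg_trans (df _ It) => A /= [e /= e0 HA].
  move/nbhs_ballP: It' => [d /= d0 Hd].
  exists (Num.min e d); first by rewrite /= lt_min e0 d0.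
  move=> s /= sb st; apply: HA => //=.
    by apply: lt_le_trans sb _; rewrite ge_min lexx.
  by apply: Hd; apply: lt_le_trans sb _; rewrite ge_min lexx orbT.
have D : h^-1 *: (f (h *: 1 + t) - f t) @[h --> 0^'] --> f' t.
  apply/cvgrPdist_le => e e0; move/cvgrPdist_le: H => /(_ _ e0).
  move=> /nbhs_ballP[d /= d0 Hd]; apply/nbhs_ballP; exists d => //= h.
  rewrite /ball/= sub0r normrN => hd h0.
  have := Hd (h *: 1 + t); rewrite /ball/= /GRing.scale/= mulr1.
  rewrite opprD addrA addrAC subrr sub0r normrN => /(_ hd).
  have -> : h + t != t by rewrite -subr_eq0 addrK.
  by move=> /(_ isT); rewrite addrK mulrC.
split; first by apply/cvg_ex; exists (f' t).
by apply: cvg_lim.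
Qed.

End Derivative_on.

(** * Integrals over rays *)

Section Integration.
Context {R : realType}.
Implicit Types (f F h : R -> R) (b T t : R).

Lemma limf_esup_lt_pinfty f :
  (limf_esup (fun t : R => (f t)%:E) +oo%R < +oo)%E ->
  exists2 K, 0 < K & \forall t \near +oo, f t <= K.
Proof.
rewrite limf_esupE => /ereal_inf_lt[_ [V FV <-] supV].
have [K HK] : exists K : R, (ereal_sup [set (f t)%:E | t in V] <= K%:E)%E.
  case: (ereal_sup _) supV => [k _|//|_]; first by exists k.
  by exists 0; rewrite leNye.
(* The maximum with 1 ensures positivity, so that [K^-1] can serve as a lower slope for [tau_D]. *)
exists (Num.max K 1); first by rewrite lt_max ltr01 orbT.
apply: filterS FV => t Vt; rewrite le_max -lee_fin.
apply/orP; left; apply: le_trans HK.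
by apply: ereal_sup_ubound; exists t.
Qed.

Lemma continuous_ray_within f T : (forall t, T <= t -> {for t, continuous f}) ->
  {within `[T, +oo[, continuous f}.
Proof.
move=> cf; apply: continuous_in_subspaceT => t; rewrite inE/= in_itv/= andbT.
exact: cf.
Qed.

Lemma FTC_ray f F T : (forall t, T <= t -> is_derive t (1 : R) F (f t)) ->
  (forall t, T <= t -> {for t, continuous f}) -> forall t, T <= t ->
  (leb R).-integrable `[T, t] (fun s => (f s)%:E) /\
  \int[leb R]_(s in `[T, t]) f s = F t - F T.
Proof.
move=> dF cf t Tt.
have wf := continuous_ray_within cf.
split; first exact: (within_cy_integrable t wf (lexx T)).
move: Tt; rewrite le_eqVlt => /predU1P[<-|Tt].
  by rewrite set_itv1 Rintegral_set1 subrr.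
rewrite /Rintegral (@continuous_FTC2 R f F T t Tt).
- by rewrite -EFinB.
- exact: (within_cy_segment wf (lexx T)).
- have cF s : T <= s -> {for s, continuous F}.
    move=> /dF [d _]; exact: derivable1_continuous.
  split.
  + by move=> s; rewrite in_itv/= => /andP[/ltW/dF[]].
  + by apply: cvg_at_right_filter; apply: cF.
  + by apply: cvg_at_left_filter; apply: cF; exact: ltW.
- move=> s; rewrite in_itv/= => /andP[/ltW/dF[d1 d2] _].
  by rewrite derive1E d2.
Qed.

(** The sign of [f] turns the finite value of the improper integral into integrability on the
    ray. *)
Lemma FTC_ray_pinfty f F T (l : R) :
  (forall t, T <= t -> is_derive t (1 : R) F (f t)) ->
  (forall t, T <= t -> {for t, continuous f}) ->
  (forall t, T <= t -> 0 <= f t) -> F t @[t --> +oo] --> l ->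
  (leb R).-integrable `[T, +oo[ (fun s => (f s)%:E) /\
  \int[leb R]_(s in `[T, +oo[) f s = l - F T.
Proof.
move=> dF cf f0 Fl.
have wf := continuous_ray_within cf.
have E : (\int[leb R]_(s in `[T, +oo[) (f s)%:E = l%:E - (F T)%:E)%E.
  apply: ge0_continuous_FTC2y => //.
  - by move=> s /ltW/dF[].
  - have [d _] := dF _ (lexx T).
    by apply: cvg_at_right_filter; exact: derivable1_continuous.
  - move=> s; rewrite in_itv/= andbT => /ltW/dF[d1 d2].
    by rewrite derive1E d2.
split; last by rewrite /Rintegral E -EFinB.
apply/integrableP; split.
  apply/measurable_EFinP; exact: within_cy_measurable.
under eq_integral => s.
  rewrite inE/= in_itv/= andbT => /f0 fs.
  rewrite /= ger0_norm//.
  over.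
by rewrite E -EFinB ltry.
Qed.

Lemma within_cy_powR f b (z : R) : {within `[b, +oo[, continuous f} ->
  (forall t, b <= t -> 0 < f t) -> {within `[b, +oo[, continuous (fun t => f t `^ z)}.
Proof.
move=> /continuous_within_itvcyP[cf fb] f0; apply/continuous_within_itvcyP; split.
  move=> t tb; have := tb; rewrite in_itv/= andbT => bt.
  by apply: cvg_powR; [exact/f0/ltW|exact: cf].
by apply: cvg_powR => //; exact: f0.
Qed.

(** The integrands of the asymptotic formulas are dictated by the solution beyond some point and are
    free before it; gluing chooses them there so that the constants come out right. *)
Definition glue T f h : R -> R := fun s => if s < T then f s else h s.

(** The right bound [B] is arbitrary so that both [[b, t]] and the ray from [b] are covered. *)
Lemma glue_integral f h b T (B : itv_bound R) : b <= T -> (BLeft T <= B)%O ->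
  (leb R).-integrable `[b, T] (fun s => (f s)%:E) ->
  (leb R).-integrable [set` Interval (BLeft T) B] (fun s => (h s)%:E) ->
  (leb R).-integrable [set` Interval (BLeft b) B] (fun s => (glue T f h s)%:E) /\
  \int[leb R]_(s in [set` Interval (BLeft b) B]) glue T f h s =
  \int[leb R]_(s in `[b, T]) f s +
  \int[leb R]_(s in [set` Interval (BLeft T) B]) h s.
Proof.
move=> bT TB intf inth.
have E : [set` Interval (BLeft b) B] =
    [set` Interval (BLeft b) (BLeft T)] `|` [set` Interval (BLeft T) B].
  by apply: itv_bndbnd_setU.
have intf' : (leb R).-integrable [set` Interval (BLeft b) (BLeft T)] (fun s => (f s)%:E).
  apply: integrableS intf => //; apply: subset_itvl; rewrite bnd_simp//.
have g1 : {in [set` Interval (BLeft b) (BLeft T)], f =1 glue T f h}.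
  by move=> s; rewrite inE/= in_itv/= /glue => /andP[_ ->].
have g2 : {in [set` Interval (BLeft T) B], h =1 glue T f h}.
  move=> s; rewrite inE/= itv_boundlr => /andP[+ _]; rewrite bnd_simp => Ts.
  by rewrite /glue ltNge Ts.
have i1 : (leb R).-integrable [set` Interval (BLeft b) (BLeft T)]
    (fun s => (glue T f h s)%:E).
  by apply: eq_integrable intf' => // s /g1 ->.
have i2 : (leb R).-integrable [set` Interval (BLeft T) B] (fun s => (glue T f h s)%:E).
  by apply: eq_integrable inth => // s /g2 ->.
have i12 : (leb R).-integrable [set` Interval (BLeft b) B]
    (fun s => (glue T f h s)%:E).
  rewrite E; apply/integrableP; split.
    by apply/measurable_funU => //; split; [have /integrableP[] := i1|have /integrableP[] := i2].
  rewrite ge0_integral_setU//; first last.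
  - apply/disj_setPS => s /= [+ +]; rewrite !itv_boundlr !bnd_simp.
    by move=> /andP[_ sT] /andP[Ts _]; move: sT; rewrite ltNge Ts.
  - apply: measurableT_comp => //.
    by apply/measurable_funU => //; split; [have /integrableP[] := i1|have /integrableP[] := i2].
  by apply: lte_add_pinfty; [have /integrableP[] := i1|have /integrableP[] := i2].
split => //.
rewrite E Rintegral_setU//; first last.
- apply/disj_setPS => s /= [+ +]; rewrite !itv_boundlr !bnd_simp.
  by move=> /andP[_ sT] /andP[Ts _]; move: sT; rewrite ltNge Ts.
- by rewrite -E.
rewrite -(Rintegral_itv_bndo_bndc intf').
by congr (_ + _); apply: eq_Rintegral => s; [move/g1|move/g2].
Qed.

Lemma within_cy_bounded b f T : {within `[b, +oo[, continuous f} ->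
  exists2 K, 0 <= K & forall t, b <= t <= T -> `|f t| <= K.
Proof.
move=> cf; have [Tb|bT] := ltP T b.
  by exists 0 => // t /andP[bt tT]; move: Tb; rewrite ltNge (le_trans bt).
have wf := within_cy_segment (t := T) cf (lexx b).
have [c _ Hc] := EVT_max bT wf; have [d _ Hd] := EVT_min bT wf.
exists (Num.max `|f c| `|f d|); first by rewrite le_max normr_ge0.
move=> t btT; have tI : t \in `[b, T] by rewrite in_itv.
have := Hc _ tI; have := Hd _ tI => h1 h2.
rewrite ler_norml; apply/andP; split.
  rewrite (le_trans _ h1)// lerNl le_max; apply/orP; right.
  by rewrite -normrN ler_norm.
by rewrite (le_trans h2)// le_max ler_norm.
Qed.

End Integration.

(** * The delay equation *)

Section Equation.
Context (R : realType) (a alpha beta : R) (r p tau tau' : R -> R)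
  (alpha_gt1 : 1 < alpha)
  (conj_alpha_beta : alpha^-1 + beta^-1 = 1)
  (r_cont : {within `[a, +oo[, continuous r})
  (p_cont : {within `[a, +oo[, continuous p})
  (r_gt0 : forall t, a <= t -> 0 < r t)
  (p_gt0 : forall t, a <= t -> 0 < p t)
  (r_int : (\int[leb R]_(s in `[a, +oo[) (r s `^ (1 - beta))%:E = +oo)%E)
  (p_D_RV : RV (- alpha) (p_D a beta r p))
  (L_p_D : Lpart (- alpha) (p_D a beta r p) t @[t --> +oo] --> (0 : R))
  (tau_C1 : C1_on `[a, +oo[ tau tau')
  (tau'_gt0 : forall t, a <= t -> 0 < tau' t)
  (tau_le : forall t, a <= t -> tau t <= t)
  (tau_ge : \forall t \near +oo, a <= tau t)
  (tau_D_limsup :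
    (limf_esup (fun t : R => (t / tau_D a beta r tau t)%:E) +oo%R < +oo)%E)
  (tau_D'_SV : SV (derive1 (tau_D a beta r tau))).

Let rho t := r t `^ (1 - beta).
Let G := R_D a beta r.
Let g := R_Dinv a beta r.
Let theta := tau_D a beta r tau.
Let P := p_D a beta r p.
Let f := derive1 theta.

(** * Conjugate exponents and the variable [s = R_D t] *)

Lemma conj_beta_sub1 : beta - 1 = (alpha - 1)^-1.
Proof.
have a0 : alpha != 0 by rewrite gt_eqF// (lt_trans ltr01).
(* By convention [0^-1 = 0], so [beta = 0] would force [alpha = 1]. *)
have b0 : beta != 0.
  apply: contraPneq conj_alpha_beta => ->; rewrite invr0 addr0 => /(congr1 (@GRing.inv _)).
  rewrite invrK invr1 => E; by move: alpha_gt1; rewrite E ltxx.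
have a1 : alpha - 1 != 0 by rewrite gt_eqF// subr_gt0.
have E : beta + alpha = alpha * beta.
  move/(congr1 (fun z => alpha * beta * z)): conj_alpha_beta.
  rewrite mulr1 => <-; field; by rewrite a0 b0.
apply: (mulfI a1); rewrite mulfV//; move: E; lra.
Qed.

Lemma alpha_sub1_gt0 : 0 < alpha - 1. Proof. by rewrite subr_gt0. Qed.

Lemma beta_sub1_gt0 : 0 < beta - 1.
Proof. by rewrite conj_beta_sub1 invr_gt0 alpha_sub1_gt0. Qed.

Lemma rho_cont : {within `[a, +oo[, continuous rho}.
Proof. exact: within_cy_powR. Qed.

Lemma rho_gt0 (t : R) : a <= t -> 0 < rho t.
Proof. by move=> at'; rewrite powR_gt0// r_gt0. Qed.

Lemma rhoV (t : R) : (rho t)^-1 = r t `^ (beta - 1).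
Proof. by rewrite /rho -powRN opprB. Qed.

Lemma R_D_is_derive (t : R) : a < t -> is_derive t (1 : R) G (rho t).
Proof. exact: (primitive_is_derive rho_cont). Qed.

Lemma R_D_lt (s t : R) : a <= s -> s < t -> G s < G t.
Proof. exact: (primitive_lt rho_cont rho_gt0). Qed.

Lemma R_D_le (s t : R) : a <= s -> s <= t -> G s <= G t.
Proof. exact: (primitive_le rho_cont rho_gt0). Qed.

Lemma R_D_gt0 (t : R) : a < t -> 0 < G t.
Proof. exact: (primitive_gt0 rho_cont rho_gt0). Qed.

Lemma R_D_cvg : G t @[t --> +oo] --> (+oo : set_system R).
Proof. exact: (primitive_cvg rho_cont rho_gt0 r_int). Qed.

Lemma R_DK (t : R) : a <= t -> g (G t) = t.
Proof. exact: (primitive_invK rho_cont rho_gt0). Qed.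

Lemma R_DinvK (s : R) : 0 <= s -> G (g s) = s.
Proof. exact: (primitiveK rho_cont rho_gt0 r_int). Qed.

Lemma R_Dinv_gt (s : R) : 0 < s -> a < g s.
Proof. exact: (primitive_inv_gt rho_cont rho_gt0 r_int). Qed.

Lemma R_Dinv_is_derive (s : R) : 0 < s -> is_derive s (1 : R) g (rho (g s))^-1.
Proof. exact: (primitive_inv_is_derive rho_cont rho_gt0 r_int). Qed.

Lemma R_Dinv_cvg : g s @[s --> +oo] --> (+oo : set_system R).
Proof. exact: (primitive_inv_cvg rho_cont rho_gt0 r_int). Qed.

Lemma near_R_Dinv (A : R -> Prop) : (\forall t \near +oo, A t) ->
  \forall s \near +oo, A (g s).
Proof. by move=> H; exact: R_Dinv_cvg. Qed.

Lemma R_Dinv_continuous (s : R) : 0 < s -> {for s, continuous g}.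
Proof.
move=> /R_Dinv_is_derive[d _].
exact: derivable1_continuous.
Qed.

(** * The delay in both variables *)

Lemma tau_is_derive (t : R) : a < t -> is_derive t (1 : R) tau (tau' t).
Proof.
apply: (derivative_on_is_derive tau_C1.1) => s as'.
by rewrite /= in_itv/= as'.
Qed.

(** At [s = a] only a one-sided derivative exists. Its positivity provides a point [u] in []s, t[]
    with [tau s < tau u], and beyond [u] the two-sided derivative takes over. *)
Lemma tau_lt (s t : R) : a <= s -> s < t -> tau s < tau t.
Proof.
move=> as' st.
have sI : (`[a, +oo[%classic : set R) s by rewrite /= in_itv/= as'.
have [e /= e0 He] : \forall u \near within `[a, +oo[%classic s^',
    0 < (tau u - tau s) / (u - s).
  have := tau_C1.1 _ sI => /cvgr_gt; apply.
  exact: tau'_gt0.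
pose u := s + Num.min e (t - s) / 2.
have m0 : 0 < Num.min e (t - s) by rewrite lt_min e0 subr_gt0.
have su : s < u by rewrite ltrDl divr_gt0.
have ut : u < t.
  rewrite -ltrBDl ltr_pdivrMr//.
  have : Num.min e (t - s) <= t - s by rewrite ge_min lexx orbT.
  by move: m0; lra.
have au : a < u by exact: le_lt_trans su.
have := He u; rewrite /ball/= opprD addrA subrr sub0r normrN ger0_norm; last first.
  by rewrite divr_ge0// ltW.
have -> : Num.min e (t - s) / 2 < e.
  have : Num.min e (t - s) <= e by rewrite ge_min lexx.
  by move: m0; lra.
move=> /(_ isT); rewrite gt_eqF// => /(_ isT).
have -> : u \in `[a, +oo[ by rewrite in_itv/= ltW.
move=> /(_ isT); rewrite pmulr_lgt0 ?invr_gt0 ?subr_gt0// => tsu.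
apply: lt_trans tsu _.
apply: (@derive_gt0_increasing _ tau tau' u) => // z uz.
  by apply: tau_is_derive; exact: lt_le_trans uz.
by apply: tau'_gt0; rewrite (le_trans (ltW au)).
Qed.

(** The strict inequality puts [tau t] where [R_D] has a two-sided derivative, as the chain rule for
    [tau_D] requires. *)
Lemma near_tau_gt : \forall t \near +oo, a < tau t.
Proof.
have [X X0 HX] : exists2 X : R, 0 < X & forall t, X <= t -> a <= t /\ a <= tau t.
  by apply: near_pinfty_ge; apply: filterS2 (nbhs_pinfty_ge (num_real a)) tau_ge.
near=> t; have [aX atX] := HX _ (lexx X).
have Xt : X < t by near: t; apply: nbhs_pinfty_gt; rewrite num_real.
exact: le_lt_trans atX (tau_lt aX Xt).
Unshelve. all: by end_near. Qed.

Lemma theta_is_derive (s : R) : 0 < s -> a < tau (g s) ->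
  is_derive s (1 : R) theta (rho (tau (g s)) * (tau' (g s) * (rho (g s))^-1)).
Proof.
move=> s0 atg.
have d1 := R_Dinv_is_derive s0.
have d2 := tau_is_derive (R_Dinv_gt s0).
have d3 := R_D_is_derive atg.
exact: (@is_derive1_comp R G (tau \o g) s _ _ d3 (@is_derive1_comp R tau g s _ _ d2 d1)).
Qed.

Lemma theta'E (s : R) : 0 < s -> a < tau (g s) ->
  f s = rho (tau (g s)) * (tau' (g s) * (rho (g s))^-1).
Proof. by move=> s0 atg; have [_ d] := theta_is_derive s0 atg; rewrite /f derive1E d. Qed.

Lemma theta'_gt0 (s : R) : 0 < s -> a < tau (g s) -> 0 < f s.
Proof.
move=> s0 atg; rewrite theta'E// mulr_gt0 ?rho_gt0 ?(ltW atg)//.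
have ag := ltW (R_Dinv_gt s0).
by rewrite mulr_gt0 ?invr_gt0 ?tau'_gt0 ?rho_gt0.
Qed.

Lemma near_theta : \forall s \near +oo, 0 < s /\ a < tau (g s).
Proof.
have H := near_R_Dinv near_tau_gt.
by near=> s; split; [|near: s].
Unshelve. all: by end_near. Qed.

Lemma near_theta_is_derive : \forall s \near +oo, is_derive s (1 : R) theta (f s).
Proof.
apply: filterS near_theta => s [s0 atg].
by rewrite theta'E//; exact: theta_is_derive.
Qed.

Lemma near_theta'_gt0 : \forall s \near +oo, 0 < f s.
Proof. by apply: filterS near_theta => s [s0 atg]; exact: theta'_gt0. Qed.

(** The two conditions of [theta'E] are open, so the chain-rule formula holds on a neighbourhood of
    [s] and its continuity passes to [f]. *)
Lemma theta'_continuous (s : R) : 0 < s -> a < tau (g s) -> {for s, continuous f}.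
Proof.
move=> s0 atg; have ct' := tau_C1.2.
have ag := R_Dinv_gt s0.
have cg := R_Dinv_continuous s0.
have ctau : {for g s, continuous tau}.
  have [d _] := tau_is_derive ag.
  exact: derivable1_continuous.
have cE : {for s, continuous (fun s => rho (tau (g s)) * (tau' (g s) * (rho (g s))^-1))}.
  apply: cvgM.
    have crho := within_cy_continuous_at rho_cont atg.
    exact: (continuous_comp (continuous_comp cg ctau) crho).
  apply: cvgM.
    exact: (continuous_comp cg (within_cy_continuous_at ct' ag)).
  apply: cvgV; first by rewrite gt_eqF// rho_gt0// ltW.
  exact: (continuous_comp cg (within_cy_continuous_at rho_cont ag)).
rewrite /prop_for /continuous_at theta'E//; move: cE; apply: cvg_trans.
apply: near_eq_cvg; near=> u.
have u0 : 0 < u by near: u; exact: lt_nbhsr.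
have atu : a < tau (g u).
  by near: u; move: (continuous_comp cg ctau) => /cvgr_gt; apply.
by rewrite theta'E.
Unshelve. all: by end_near. Qed.

Lemma near_theta'_continuous : \forall s \near +oo, {for s, continuous f}.
Proof. by apply: filterS near_theta => s [s0 atg]; exact: theta'_continuous. Qed.

Lemma near_theta_le : \forall s \near +oo, theta s <= s.
Proof.
apply: filterS near_theta => s [s0 atg].
rewrite -[leRHS](R_DinvK (ltW s0)) R_D_le ?(ltW atg)// tau_le// ltW//.
exact: R_Dinv_gt.
Qed.

Lemma near_theta_ge : exists2 c, 0 < c & \forall s \near +oo, c * s <= theta s.
Proof.
have [K K0 HK] := limf_esup_lt_pinfty tau_D_limsup.
exists K^-1; first by rewrite invr_gt0.
apply: filterS2 near_theta HK => s [s0 atg].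
have th0 : 0 < theta s by exact: R_D_gt0.
by rewrite ler_pdivrMr// ler_pdivrMl.
Qed.

(** The linear lower bound on [tau_D] makes [R_D (tau t)] tend to infinity, and [R_D] is
    increasing. *)
Lemma tau_cvg : tau t @[t --> +oo] --> (+oo : set_system R).
Proof.
have [c c0 Hc] := near_theta_ge.
have thy : theta s @[s --> +oo] --> (+oo : set_system R).
  exact: (ger_cvgy Hc (cvg_pinfty_scale c0)).
have Gtau : G (tau t) @[t --> +oo] --> (+oo : set_system R).
  apply: near_eq_cvg_pinfty (cvg_comp _ _ R_D_cvg thy); near=> t.
  by rewrite /theta /tau_D /= -/g -/G R_DK.
apply/cvgryPge => A; near=> t.
have att : a < tau t by near: t; exact: near_tau_gt.
rewrite leNgt; apply/negP => tA.
have : G (tau t) < G A by apply: R_D_lt => //; exact: ltW.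
by apply/negP; rewrite -leNgt; near: t; move/cvgryPge: Gtau; apply.
Unshelve. all: by end_near. Qed.

(** * The transformed coefficient *)

Lemma p_D_E (t : R) : a <= t -> P (G t) = p t * r t `^ (beta - 1).
Proof. by move=> at'; rewrite /P /p_D /= -/g R_DK. Qed.

Lemma near_p_D_gt0 : \forall s \near +oo, 0 < P s.
Proof.
apply: filterS (nbhs_pinfty_gt (num_real (0 : R))) => s s0.
have ag := ltW (R_Dinv_gt s0).
by rewrite /P /p_D /= mulr_gt0 ?p_gt0 ?powR_gt0 ?r_gt0.
Qed.

Lemma near_p_D_continuous : \forall s \near +oo, {for s, continuous P}.
Proof.
apply: filterS (nbhs_pinfty_gt (num_real (0 : R))) => s s0.
have ag := R_Dinv_gt s0; have cg := R_Dinv_continuous s0.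
apply: cvgM; first exact: (continuous_comp cg (within_cy_continuous_at p_cont ag)).
apply: cvg_powR; first exact/r_gt0/ltW.
exact: (continuous_comp cg (within_cy_continuous_at r_cont ag)).
Qed.

Lemma slow_SV (h : R -> R) : SV h -> slow h.
Proof. by move=> [_ _ H] l /H; rewrite powRr0. Qed.

Lemma slow_l : slow (fun t => t * t `^ (alpha - 1) * P t).
Proof.
move=> l l0; have [_ _ /(_ _ l0) H] := p_D_RV.
have E : l `^ alpha * l `^ (- alpha) = 1.
  by rewrite powRN mulfV// gt_eqF// powR_gt0.
rewrite -[X in _ --> X]E; apply: near_eq_cvg_pinfty (cvgM_pinfty (cvg_cst (l `^ alpha)) H).
near=> t; have t0 : 0 < t by [].
have lp : l `^ alpha = l * l `^ (alpha - 1).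
  by rewrite mulr_powRB1 ?(ltW l0)// (lt_trans ltr01).
rewrite lp.
rewrite (powRM _ (ltW l0) (ltW t0)).
have Pt : 0 < P t by near: t; exact: near_p_D_gt0.
have tp : 0 < t `^ (alpha - 1) by exact: powR_gt0.
by rewrite -/P; field; rewrite !gt_eqF.
Unshelve. all: by end_near. Qed.

Lemma cvg_l : t * t `^ (alpha - 1) * P t @[t --> +oo] --> (0 : R).
Proof.
apply: near_eq_cvg_pinfty L_p_D; near=> t; have t0 : 0 < t by [].
rewrite /Lpart mulr_powRB1 ?(ltW t0) ?(lt_trans ltr01)//.
by rewrite powRN invrK mulrC.
Unshelve. all: by end_near. Qed.

Lemma Phi_gt0 (u : R) : 0 < u -> Phi alpha u = u `^ (alpha - 1).
Proof. by move=> u0; rewrite /Phi gtr0_norm// gtr0_sg// mulr1. Qed.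

(** * A solution in the new variable *)

Context (y : R -> R) (y_IS : sol_IS a alpha r p tau y).
Let y1 := derive1 y.
Let W := quasi alpha r y.

(** An interval without upper bound contains a ray. Since [tau] tends to infinity, the delayed
    argument enters that ray, and from then on the equation is available at every point. *)
Lemma near_solution : \forall t \near +oo,
  [/\ is_derive t (1 : R) y (y1 t), 0 < y t, 0 < y1 t &
      is_derive t (1 : R) W (p t * y (tau t) `^ (alpha - 1))].
Proof.
have [[I [[Iitv Ia [y' [w' [[dy _] [dW _] eqn]]]] Inb y0]] y10] := y_IS.
have [i0 Ii0] : exists i0, I i0.
  apply: contrapT => nI; apply: Inb; exists 0 => i Ii.
  by exfalso; apply: nI; exists i.
have I0 t : i0 <= t -> I t.
  move=> i0t; apply: contrapT => nIt; apply: Inb; exists t => i Ii.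
  rewrite leNgt; apply/negP => ti; apply: nIt.
  by apply: (Iitv i0 i) => //; rewrite i0t ltW.
have dy' t : i0 < t -> is_derive t (1 : R) y (y' t).
  exact: derivative_on_is_derive dy I0.
have y1E t : i0 < t -> y1 t = y' t.
  by move=> /dy'[_ d]; rewrite /y1 derive1E d.
have yt0 : \forall t \near +oo, 0 < y (tau t) by exact: (tau_cvg y0).
have ti : \forall t \near +oo, i0 <= tau t.
  by move: tau_cvg => /cvgryPge; apply.
near=> t.
have it : i0 < t by near: t; apply: nbhs_pinfty_gt; rewrite num_real.
split; [by rewrite y1E//; exact: dy'|by near: t|by near: t|].
have -> : p t * y (tau t) `^ (alpha - 1) = w' t.
  rewrite eqn; first by rewrite Phi_gt0//; near: t.
    exact/I0/ltW.
  by apply: I0; near: t.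
(* [W] is built from [derive1 y], the equation from the witness [y']; they agree near [t], which
   suffices for the derivative. *)
apply: (near_eq_is_derive _ (derivative_on_is_derive dW I0 it)).
near=> u; rewrite /W /quasi -/(y1 u) y1E//.
by near: u; exact: lt_nbhsr.
Unshelve. all: by end_near. Qed.

(** The weight cancels: raising [W = r * y1 ^ (alpha - 1)] to the power [(alpha - 1)^-1 = beta - 1]
    gives [r ^ (beta - 1) * y1], which is [y1 / rho], the derivative of [y] in the new variable. *)
Lemma near_solution_inv : \forall s \near +oo,
  [/\ is_derive s (1 : R) (y \o g) ((W \o g) s `^ (alpha - 1)^-1),
      0 < (y \o g) s, 0 < (W \o g) s &
      is_derive s (1 : R) (W \o g) (P s * (y \o g) (theta s) `^ (alpha - 1))].
Proof.
have H := near_R_Dinv near_solution.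
near=> s.
have s0 : 0 < s by [].
have atg : a < tau (g s) by near: s; apply: filterS near_theta => ? [].
have ag := ltW (R_Dinv_gt s0).
have [dy yp y1p dW] : [/\ is_derive (g s) (1 : R) y (y1 (g s)), 0 < y (g s),
  0 < y1 (g s) & is_derive (g s) (1 : R) W (p (g s) * y (tau (g s)) `^ (alpha - 1))].
  by near: s.
have dg := R_Dinv_is_derive s0.
have rg := r_gt0 ag.
have a1 : alpha - 1 != 0 by rewrite gt_eqF// alpha_sub1_gt0.
split => //.
- have := @is_derive1_comp R y g s _ _ dy dg.
  suff -> : (W \o g) s `^ (alpha - 1)^-1 = y1 (g s) * (rho (g s))^-1 by [].
  rewrite /W /quasi /= -/(y1 (g s)) Phi_gt0// powRM ?powR_ge0 ?(ltW rg)//.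
  by rewrite -powRrM mulfV// powRr1 ?(ltW y1p)// -conj_beta_sub1 -rhoV mulrC.
- by rewrite /W /quasi /= -/(y1 (g s)) Phi_gt0// mulr_gt0// powR_gt0.
- have := @is_derive1_comp R W g s _ _ dW dg.
  rewrite /theta /tau_D /= -/g -/G R_DK ?(ltW atg)//.
  suff -> : P s * y (tau (g s)) `^ (alpha - 1) =
    p (g s) * y (tau (g s)) `^ (alpha - 1) * (rho (g s))^-1 by [].
  by rewrite /P /p_D /= -/g rhoV; ring.
Unshelve. all: by end_near. Qed.

Let v s := (W \o g) s `^ (alpha - 1)^-1.
Let Q s := (f s * s) `^ (alpha - 1) * P s.
Let w' s := P s * (y \o g) (theta s) `^ (alpha - 1).

Lemma solution_asymptotics :
  [/\ (y \o g) s @[s --> +oo] --> (+oo : set_system R),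
      (y \o g) s / (s * v s) @[s --> +oo] --> (1 : R),
      w' s / ((W \o g) s * Q s) @[s --> +oo] --> (1 : R),
      (s * v s - (y \o g) s) / ((y \o g) s * ((beta - 1) * (s * Q s)))
        @[s --> +oo] --> (1 : R) &
      forall M : R, (W \o g) s @[s --> +oo] --> M ->
        s * Q s / (M - (W \o g) s) @[s --> +oo] --> (0 : R) /\
        slow (fun s => M - (W \o g) s)].
Proof.
have [c c0 Hc] := near_theta_ge.
rewrite conj_beta_sub1.
apply: (@half_linear_asymptotics R (alpha - 1) c (y \o g) (W \o g) P theta f
  alpha_sub1_gt0 c0 _ _ near_theta_is_derive _ _ near_p_D_gt0 near_theta'_gt0
  near_p_D_continuous near_theta'_continuous near_theta_le Hc (slow_SV tau_D'_SV)
  slow_l cvg_l); by apply: filterS near_solution_inv => s [].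
Qed.


(** * Return to the variable [t] *)

Let q := q_D a alpha beta r p tau.
Let w1 t := p t * y (tau t) `^ (alpha - 1).
(** For large [t] this is [derive1 y] recovered from the quasiderivative; in this form its
    continuity is visible. *)
Let V t := W t `^ (alpha - 1)^-1 * rho t.

Lemma q_D_E (t : R) : a <= t -> q t = Q (G t) * rho t.
Proof.
move=> at'; have rt := r_gt0 at'.
rewrite /q /q_D -/theta -/f -/G /Q p_D_E// -mulrA -rhoV mulfVK//.
by rewrite gt_eqF// rho_gt0.
Qed.

Lemma q_D_gt0 (t : R) : a < t -> a < tau t -> 0 < q t.
Proof.
move=> at' att; rewrite /q /q_D mulr_gt0 ?p_gt0 ?(ltW at')// powR_gt0//.
rewrite mulr_gt0 ?R_D_gt0//; apply: theta'_gt0; first exact: R_D_gt0.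
by rewrite R_DK// ltW.
Qed.

Lemma near_q_D_gt0 : \forall t \near +oo, 0 < q t.
Proof.
apply: filterS2 (nbhs_pinfty_gt (num_real a)) near_tau_gt => t.
exact: q_D_gt0.
Qed.

Lemma near_solution_V : \forall t \near +oo,
  [/\ is_derive t (1 : R) y (V t), 0 < y t, 0 < W t,
      is_derive t (1 : R) W (w1 t) & 0 < w1 t].
Proof.
have yt0 : \forall t \near +oo, 0 < y (tau t).
  have y0 : \forall t \near +oo, 0 < y t by apply: filterS near_solution => t [].
  exact: (tau_cvg y0).
near=> t.
have at' : a <= t by [].
have [dy yp y1p dW] : [/\ is_derive t (1 : R) y (y1 t), 0 < y t,
  0 < y1 t & is_derive t (1 : R) W (w1 t)] by near: t; exact: near_solution.
have rt := r_gt0 at'.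
have a1 : alpha - 1 != 0 by rewrite gt_eqF// alpha_sub1_gt0.
split => //.
- suff -> : V t = y1 t by [].
  rewrite /V /W /quasi -/(y1 t) Phi_gt0// powRM ?powR_ge0 ?(ltW rt)//.
  rewrite -powRrM mulfV// powRr1 ?(ltW y1p)// -conj_beta_sub1 -rhoV.
  by rewrite mulrC mulVKf// gt_eqF// rho_gt0.
- by rewrite /W /quasi -/(y1 t) Phi_gt0// mulr_gt0// powR_gt0.
- rewrite mulr_gt0 ?p_gt0// powR_gt0//; near: t; exact: yt0.
Unshelve. all: by end_near. Qed.

Lemma near_W_continuous : \forall t \near +oo, {for t, continuous W}.
Proof.
apply: filterS near_solution_V => t [_ _ _ [d _] _].
exact: derivable1_continuous.
Qed.

Lemma near_w1_continuous : \forall t \near +oo, {for t, continuous w1}.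
Proof.
have H := near_solution_V.
have Ht : \forall t \near +oo, is_derive (tau t) (1 : R) y (V (tau t)) /\ 0 < y (tau t).
  by apply: (@tau_cvg (fun u => is_derive u (1 : R) y (V u) /\ 0 < y u));
    apply: filterS H => t [].
near=> t.
have at' : a < t by near: t; apply: nbhs_pinfty_gt; rewrite num_real.
have [[d _] yt] : is_derive (tau t) (1 : R) y (V (tau t)) /\ 0 < y (tau t) by near: t.
have [dtau _] := tau_is_derive at'.
have ctau : {for t, continuous tau} by exact: derivable1_continuous.
have cy : {for tau t, continuous y} := derivable1_continuous d.
apply: cvgM; first exact: within_cy_continuous_at p_cont at'.
by apply: cvg_powR => //; exact: (continuous_comp ctau cy).
Unshelve. all: by end_near. Qed.

Lemma near_V_continuous : \forall t \near +oo, {for t, continuous V}.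
Proof.
have H := near_solution_V; have cW := near_W_continuous.
near=> t.
have at' : a < t by near: t; apply: nbhs_pinfty_gt; rewrite num_real.
apply: cvgM; last exact: within_cy_continuous_at rho_cont at'.
apply: cvg_powR; last by near: t.
by near: t; apply: filterS H => t [].
Unshelve. all: by end_near. Qed.

Lemma cvg_log_derivative_W : w1 t / (W t * q t) @[t --> +oo] --> (1 : R).
Proof.
have [_ _ H _ _] := solution_asymptotics.
apply: near_eq_cvg_pinfty (cvg_comp _ _ R_D_cvg H); near=> t.
have at' : a <= t by [].
have att : a < tau t by near: t; exact: near_tau_gt.
have rt := rho_gt0 at'.
rewrite /= /w' /theta /tau_D /= -/g -/G !R_DK ?(ltW att)// p_D_E// -rhoV q_D_E//.
rewrite /w1 !invfM; ring.
Unshelve. all: by end_near. Qed.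

(** The numerator is the derivative of [ln (y / G)]; up to the factor [rho], which cancels against
    that of [q], it is the index remainder at [s = G t] divided by [s * y]. *)
Lemma cvg_log_derivative_index :
  ((y t)^-1 * V t - (G t)^-1 * rho t) / ((beta - 1) * q t) @[t --> +oo] --> (1 : R).
Proof.
have [_ _ _ H _] := solution_asymptotics.
apply: near_eq_cvg_pinfty (cvg_comp _ _ R_D_cvg H).
have H0 := near_q_D_gt0; have HV := near_solution_V.
near=> t.
have at' : a < t by near: t; apply: nbhs_pinfty_gt; rewrite num_real.
have qt : 0 < q t by near: t.
have [_ yt _ _ _] : [/\ is_derive t (1 : R) y (V t), 0 < y t, 0 < W t,
      is_derive t (1 : R) W (w1 t) & 0 < w1 t] by near: t.
have rt := rho_gt0 (ltW at'); have Gt := R_D_gt0 at'.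
have b1 := beta_sub1_gt0.
have Qt : 0 < Q (G t) by move: qt; rewrite q_D_E ?(ltW at')// pmulr_lgt0.
rewrite /= /v /= R_DK ?(ltW at')// q_D_E ?(ltW at')// /V.
set z := W t `^ _; field; rewrite !gt_eqF//.
Unshelve. all: by end_near. Qed.

(** Taking [psi s] as [s * x' / x - 1] makes [psi s / s] the derivative of [ln (x s / s)], so the
    representation is exact from [T] on, with constant [x T / T]. *)
Lemma NRV_solution : NRV 1 (y \o g).
Proof.
have [_ H _ _ _] := solution_asymptotics.
pose x s := (y \o g) s.
pose psi s := s * v s / x s - 1.
have psi0 : psi s @[s --> +oo] --> (0 : R).
  have H' : ((y \o g) s / (s * v s))^-1 - 1 @[s --> +oo] --> (0 : R).
    rewrite -[X in _ --> X](subrr 1); apply: cvgB; last exact: cvg_cst.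
    by rewrite -[X in _ --> X]invr1; apply: cvgV.
  by apply: near_eq_cvg_pinfty H'; near=> s; rewrite invf_div.
have [T T0 HT] := near_pinfty_ge near_solution_inv.
have cx s : T <= s -> {for s, continuous x}.
  move=> /HT[[d _] _ _ _]; exact: derivable1_continuous.
have cv s : T <= s -> {for s, continuous v}.
  move=> /HT[_ _ Ws [d _]]; apply: cvg_powR => //.
  exact: derivable1_continuous.
have cpsi s : T <= s -> {for s, continuous psi}.
  move=> Ts; have [_ xs _ _] := HT _ Ts.
  apply: cvgB; last exact: cvg_cst.
  apply: cvgM; first by apply: cvgM; [exact: cvg_id|exact: cv].
  by apply: cvgV; [rewrite gt_eqF|exact: cx].
have cpsis s : T <= s -> {for s, continuous (fun s => psi s / s)}.
  move=> Ts; apply: cvgM; first exact: cpsi.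
  by apply: cvgV; [rewrite gt_eqF// (lt_le_trans T0)|exact: cvg_id].
have dF s : T <= s -> is_derive s (1 : R) (fun s => ln (x s) - ln s) (psi s / s).
  move=> Ts; have [dx xs _ _] := HT _ Ts; have s0 := lt_le_trans T0 Ts.
  have := is_deriveB (@is_derive1_comp R (@ln R) x s _ _ (is_derive1_ln xs) dx)
    (is_derive1_ln s0).
  suff -> : psi s / s = (x s)^-1 * (W \o g) s `^ (alpha - 1)^-1 - s^-1 by [].
  rewrite /psi /v; set z := _ `^ _; field.
  by rewrite !gt_eqF.
have FTC := FTC_ray dF cpsis.
exists T, (x T / T), psi; split => //.
- by split => //; rewrite divr_gt0//; have [] := HT _ (lexx T).
- apply: measurable_funS (within_cy_measurable (continuous_ray_within cpsi)) => //.
- by move=> s Ts; have [] := FTC s Ts.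
near=> s; have Ts : T <= s by [].
have [_ ->] := FTC s Ts.
have s0 := lt_le_trans T0 Ts.
have [_ xs _ _] := HT _ Ts; have [_ xT _ _] := HT _ (lexx T).
rewrite expRB !expRB !lnK ?posrE// powRr1 ?(ltW s0)// -/(x s).
by field; rewrite !gt_eqF.
Unshelve. all: by end_near. Qed.


Lemma ratio_near1_le (h k : R -> R) : (\forall t \near +oo, 0 < k t) ->
  h t / k t @[t --> +oo] --> (1 : R) ->
  \forall t \near +oo, h t <= 2 * k t /\ k t <= 2 * h t.
Proof.
move=> k0 /cvgrPdist_le hk; have e0 : (0 : R) < 1 / 2 by lra.
have := hk _ e0; apply: filterS2 k0 => t kt.
rewrite distrC ler_distl => /andP[]; rewrite ler_pdivlMr// ler_pdivrMr//; lra.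
Qed.

Lemma near_log_W : \forall t \near +oo,
  is_derive t (1 : R) (fun t => ln (W t)) (w1 t / W t) /\
  {for t, continuous (fun t => w1 t / W t)}.
Proof.
have HV := near_solution_V; have cW := near_W_continuous.
have cw1 := near_w1_continuous.
near=> t.
have [_ _ Wt dW _] : [/\ is_derive t (1 : R) y (V t), 0 < y t, 0 < W t,
      is_derive t (1 : R) W (w1 t) & 0 < w1 t] by near: t.
split.
  have := @is_derive1_comp R (@ln R) W t _ _ (is_derive1_ln Wt) dW.
  by rewrite mulrC.
apply: cvgM; first by near: t.
by apply: cvgV; [rewrite gt_eqF|near: t].
Unshelve. all: by end_near. Qed.

(** This two-sided comparison makes boundedness of [ln W] equivalent to integrability of [q] near
    infinity; each of the two cases uses one side. *)
Lemma near_W'_le : \forall t \near +oo,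
  [/\ 0 <= w1 t / W t, w1 t / W t <= 2 * q t & q t <= 2 * (w1 t / W t)].
Proof.
have H : w1 t / W t / q t @[t --> +oo] --> (1 : R).
  apply: near_eq_cvg_pinfty cvg_log_derivative_W.
  by near=> t; rewrite invfM mulrA.
have := ratio_near1_le near_q_D_gt0 H.
apply: filterS2 near_solution_V => t [_ _ Wt _ w1t] [h1 h2].
by split => //; rewrite divr_ge0 ?ltW.
Unshelve. all: by end_near. Qed.

(** * Measurability and local integrability of [q_D] *)

Lemma measurable_q_D (b : R) : a <= b -> a <= tau b ->
  measurable_fun (`[b, +oo[ : set R) q.
Proof.
(* At [b] itself [tau b = a] is allowed, where [derive1] of [tau_D] may be a default value. Removing
   this one point does not affect measurability. *)
move=> ab atb; apply/measurable_fun_itv_obnd_cbndP.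
apply: open_continuous_measurable_fun; first exact: interval_open.
move=> t; rewrite inE/= in_itv/= andbT => bt.
have at' := le_lt_trans ab bt.
have att := le_lt_trans atb (tau_lt ab bt).
have G0 := R_D_gt0 at'.
have cG : {for t, continuous G}.
  have [d _] := R_D_is_derive at'.
  exact: derivable1_continuous.
have atg : a < tau (g (G t)) by rewrite R_DK// ltW.
apply: cvgM; last exact: within_cy_continuous_at p_cont at'.
apply: cvg_powR; first by rewrite mulr_gt0//; exact: theta'_gt0.
apply: cvgM => //.
exact: (continuous_comp cG (theta'_continuous G0 atg)).
Qed.

(** Continuity on the half-open []b, T]] gives no bound near [b]. The chain-rule formula does: it
    expresses [q] through functions continuous on [[a, T]], an interval that contains [tau t] as
    well as [t]. *)
Lemma integrable_q_D (b T : R) : a <= b -> a <= tau b ->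
  (leb R).-integrable `[b, T] (fun s => (q s)%:E).
Proof.
move=> ab atb.
have mq : measurable_fun (`[b, T] : set R) q.
  apply: measurable_funS (measurable_q_D ab atb) => //.
  by move=> t; rewrite /= !in_itv/= andbT => /andP[].
have [K1 K10 HK1] := within_cy_bounded T rho_cont.
have [K2 K20 HK2] := within_cy_bounded T tau_C1.2.
have [K3 K30 HK3] := within_cy_bounded T
  (within_cy_powR (z := beta - 1) r_cont r_gt0).
have [K4 K40 HK4] := within_cy_bounded T p_cont.
pose K := (K1 * (K2 * K3) * G T) `^ (alpha - 1) * K4.
have HK t : b < t -> t <= T -> `|q t| <= K.
  move=> bt tT.
  have at' := le_lt_trans ab bt.
  have att := le_lt_trans atb (tau_lt ab bt).
  have G0 := R_D_gt0 at'.
  have atg : a < tau (g (G t)) by rewrite R_DK// ltW.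
  have aT : a <= t <= T by rewrite ltW.
  have GT : G t <= G T by apply: R_D_le => //; exact: ltW.
  rewrite ger0_norm ?(ltW (q_D_gt0 at' att))// /q /q_D -/G -/theta -/f.
  rewrite theta'E// !R_DK ?(ltW at')// rhoV.
  have h1 : rho (tau t) <= K1.
    by rewrite (le_trans (ler_norm _))// HK1// (ltW att) (le_trans (tau_le (ltW at'))).
  have h2 : tau' t <= K2 by rewrite (le_trans (ler_norm _))// HK2.
  have h3 : r t `^ (beta - 1) <= K3 by rewrite (le_trans (ler_norm _))// HK3.
  have h4 : p t <= K4 by rewrite (le_trans (ler_norm _))// HK4.
  have t0 := ltW (tau'_gt0 (ltW at')).
  have r0 := ltW (rho_gt0 (ltW att)).
  have m1 : tau' t * r t `^ (beta - 1) <= K2 * K3 by apply: ler_pM => //; exact: powR_ge0.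
  have m10 : 0 <= tau' t * r t `^ (beta - 1) by rewrite mulr_ge0 ?powR_ge0.
  have m2 : rho (tau t) * (tau' t * r t `^ (beta - 1)) <= K1 * (K2 * K3).
    by apply: ler_pM.
  have m20 : 0 <= rho (tau t) * (tau' t * r t `^ (beta - 1)) by rewrite mulr_ge0.
  apply: (ler_pM (powR_ge0 _ _) (ltW (p_gt0 (ltW at'))) _ h4).
  have m3 := ler_pM m20 (ltW G0) m2 GT.
  have m30 := mulr_ge0 m20 (ltW G0).
  apply: (ge0_ler_powR _ _ _ m3); first exact/ltW/alpha_sub1_gt0.
  - by rewrite nnegrE.
  - by rewrite nnegrE; exact: le_trans m30 m3.
apply: measurable_bounded_integrable => //.
  by rewrite /= lebesgue_measure_itv /=; case: ifP => _; rewrite ?ltry// -EFinB ltry.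
(* The second entry covers the uncontrolled value at [b]. *)
exists (Num.max K `|q b|); split; first exact: num_real.
move=> M; rewrite gt_max => /andP[KM bM] t; rewrite /= in_itv/= => /andP[].
rewrite le_eqVlt => /predU1P[<- _|bt tT]; first exact: ltW.
by rewrite (le_trans (HK _ bt tT))// ltW.
Qed.

(** * The limit of the quasiderivative and the integral of [q_D] *)

Lemma W_cvg : (exists M : R, W t @[t --> +oo] --> M) \/
  W t @[t --> +oo] --> (+oo : set_system R).
Proof.
apply: (@increasing_cvg_or_pinfty R W w1).
  by apply: filterS near_solution_V => t [].
by apply: filterS near_solution_V => t [].
Qed.

Lemma W_limit_gt0 (M : R) : W t @[t --> +oo] --> M -> 0 < M.
Proof.
move=> WM.
have HV := near_solution_V.
have WltM : \forall t \near +oo, W t < M.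
  by apply: (@increasing_lt_limit R W w1 M) => //; apply: filterS HV => t [].
near (pinfty_nbhs R) => t.
have WtM : W t < M by near: t.
apply: le_lt_trans WtM; apply: ltW.
by near: t; apply: filterS HV => t [].
Unshelve. all: by end_near. Qed.

(** A finite limit of [W] makes [ln W] converge, so its derivative is integrable near infinity, and
    with it [q], being at most twice as large. *)
Lemma W_pinfty (b : R) : a <= b -> a <= tau b ->
  (\int[leb R]_(s in `[b, +oo[) (q s)%:E = +oo)%E ->
  W t @[t --> +oo] --> (+oo : set_system R).
Proof.
move=> ab atb intq; have [[M WM]|//] := W_cvg.
have M0 := W_limit_gt0 WM; exfalso.
have lnW : ln (W t) @[t --> +oo] --> ln M.
  by apply: (@continuous_cvg _ _ _ _ _ _ (@ln R)) => //; exact: continuous_ln.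
have [T0 _ HT0] : exists2 X : R, 0 < X & forall t, X <= t ->
   (is_derive t (1 : R) (fun t => ln (W t)) (w1 t / W t) /\
    {for t, continuous (fun t => w1 t / W t)}) /\
   [/\ 0 <= w1 t / W t, w1 t / W t <= 2 * q t & q t <= 2 * (w1 t / W t)].
  by apply: near_pinfty_ge; apply: filterS2 near_log_W near_W'_le.
pose T := Num.max T0 b.
have HT t : T <= t -> (is_derive t (1 : R) (fun t => ln (W t)) (w1 t / W t) /\
    {for t, continuous (fun t => w1 t / W t)}) /\
   [/\ 0 <= w1 t / W t, w1 t / W t <= 2 * q t & q t <= 2 * (w1 t / W t)].
  by rewrite ge_max => /andP[/HT0].
have bT : b <= T by rewrite le_max lexx orbT.
have [intW _] := FTC_ray_pinfty (fun t h => (HT t h).1.1) (fun t h => (HT t h).1.2)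
  (fun t h => let: And3 h0 _ _ := (HT t h).2 in h0) lnW.
have intqT : (leb R).-integrable `[T, +oo[ (fun s => (q s)%:E).
  have int2 : (leb R).-integrable `[T, +oo[ (fun s => 2%:E * (w1 s / W s)%:E)%E.
    exact: integrableZl.
  apply: le_integrable int2 => //.
    apply/measurable_EFinP; apply: measurable_funS (measurable_q_D ab atb) => //.
    by move=> t; rewrite /= !in_itv/= !andbT; exact: le_trans.
  move=> t; rewrite /= in_itv/= andbT => Tt.
  have [_ [h0 h1 h2]] := HT _ Tt.
  have q0 : 0 <= q t by move: h0 h1; lra.
  by rewrite lee_fin (ger0_norm q0) ger0_norm// mulr_ge0.
have [int _] := glue_integral bT (isT : (BLeft T <= BInfty R false)%O)
  (integrable_q_D T ab atb) intqT.
have gq : glue T q q = q by apply/funext => s; rewrite /glue if_same.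
rewrite gq in int.
have : (\int[leb R]_(s in `[b, +oo[) (q s)%:E)%E \is a fin_num.
  exact: integrable_fin_num.
by rewrite intq.
Qed.

(** The derivative of [ln W] is at most [2 * q], so a finite integral of [q] keeps [ln W]
    bounded. *)
Lemma W_finite (b : R) : a <= b -> a <= tau b ->
  (\int[leb R]_(s in `[b, +oo[) (q s)%:E < +oo)%E ->
  exists M : R, 0 < M /\ W t @[t --> +oo] --> M.
Proof.
move=> ab atb intq.
have [[M WM]|Wy] := W_cvg; first by exists M; split => //; exact: W_limit_gt0.
exfalso.
have [T0 _ HT0] : exists2 X : R, 0 < X & forall t, X <= t ->
   [/\ is_derive t (1 : R) (fun t => ln (W t)) (w1 t / W t),
    {for t, continuous (fun t => w1 t / W t)}, 0 <= w1 t / W t,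
    w1 t / W t <= 2 * q t & 0 < q t /\ 0 < W t].
  apply: near_pinfty_ge.
  have h1 := near_log_W; have h2 := near_W'_le; have h3 := near_q_D_gt0.
  have h4 := near_solution_V.
  near=> t.
  have [d c] : is_derive t (1 : R) (fun t => ln (W t)) (w1 t / W t) /\
    {for t, continuous (fun t => w1 t / W t)} by near: t.
  have [? ? _] : [/\ 0 <= w1 t / W t, w1 t / W t <= 2 * q t & q t <= 2 * (w1 t / W t)].
    by near: t.
  split => //; split; first by near: t.
  by near: t; apply: filterS h4 => t [].
pose T := Num.max T0 b.
have bT : b <= T by rewrite le_max lexx orbT.
have TT0 t : T <= t -> T0 <= t by rewrite ge_max => /andP[].
have q0 t : b < t -> (0 <= (q t)%:E)%E.
  move=> bt; rewrite lee_fin; apply/ltW/q_D_gt0; first exact: le_lt_trans bt.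
  exact: le_lt_trans atb (tau_lt ab bt).
have mq := measurable_q_D ab atb.
have mq' : measurable_fun (`]b, +oo[ : set R) (fun t => (q t)%:E).
  apply/measurable_EFinP; apply: measurable_funS mq => //.
  by move=> t; rewrite /= !in_itv/= !andbT; exact: ltW.
(* The endpoint is dropped because [q_D_gt0] gives the sign of [q] only beyond [b]. *)
have [K HK] : exists K : R, (\int[leb R]_(s in `]b, +oo[) (q s)%:E)%E = K%:E.
  move: intq; rewrite -integral_itv_obnd_cbnd//.
  have : (0 <= \int[leb R]_(s in `]b, +oo[) (q s)%:E)%E.
    by apply: integral_ge0 => t; rewrite /= in_itv/= andbT; exact: q0.
  by case: (\int[leb R]_(s in _) _)%E => // K _ _; exists K.
have bound t : T < t -> ln (W t) - ln (W T) <= 2 * K.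
  move=> Tt.
  have [iW <-] := FTC_ray (fun t h => let: And5 h0 _ _ _ _ := HT0 t (TT0 t h) in h0)
    (fun t h => let: And5 _ h0 _ _ _ := HT0 t (TT0 t h) in h0) (ltW Tt).
  rewrite -lee_fin /Rintegral fineK; last exact: integrable_fin_num.
  rewrite EFinM -HK -ge0_integralZl_EFin//; last first.
    by move=> s; rewrite /= in_itv/= andbT; exact: q0.
  rewrite -integral_itv_obnd_cbnd; last first.
    have /integrableP[m _] := iW; apply: measurable_funS m => //.
    by apply: subset_itvr; rewrite bnd_simp.
  apply: (@le_trans _ _ (\int[leb R]_(s in `]T, t]) (2%:E * (q s)%:E))%E).
    apply: ge0_le_integral => //.
    - move=> s; rewrite /= in_itv/= => /andP[/ltW/TT0/HT0[]] *.
      by rewrite lee_fin.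
    - have /integrableP[m _] := iW; apply: measurable_funS m => //.
      by apply: subset_itvr; rewrite bnd_simp.
    - apply: measurable_funeM; apply: measurable_funS mq' => //.
      by move=> s; rewrite /= !in_itv/= andbT => /andP[/(le_lt_trans bT)].
    - move=> s; rewrite /= in_itv/= => /andP[/ltW/TT0/HT0[]] *.
      by rewrite -EFinM lee_fin.
  apply: ge0_subset_integral => //.
  - exact: measurable_funeM.
  - move=> s; rewrite /= in_itv/= andbT => /q0 qs.
    by rewrite mule_ge0.
  - by move=> s; rewrite /= !in_itv/= andbT => /andP[/(le_lt_trans bT)].
near (pinfty_nbhs R) => t.
have Tt : T < t by near: t; apply: nbhs_pinfty_gt; rewrite num_real.
(* The summand 1 makes [ln (W t)] exceed the bound just proved. *)
have Wt : expR (2 * K + ln (W T) + 1) <= W t by near: t; move/cvgryPge : Wy; apply.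
have [_ _ _ _ [_ Wt0]] := HT0 _ (TT0 _ (ltW Tt)).
have := bound _ Tt.
rewrite -ler_ln ?posrE ?expR_gt0// expRK in Wt.
by rewrite lerBlDr => /(le_trans Wt); rewrite gerDl ler10.
Unshelve. all: by end_near. Qed.


(* With [g0 = 0] before [T], [eps] is [-1] there, so that junk or vanishing values
   of [q] on [b, T] do not matter. *)
Lemma relative_eps_cancel (g0 : R -> R) (T : R) : (forall t, t < T -> g0 t = 0) ->
  (forall t, T <= t -> 0 < q t) ->
  (fun s => (1 + (g0 s / ((beta - 1) * q s) - 1)) * (beta - 1) * q s) = g0.
Proof.
move=> g00 q0; apply/funext => s; have [sT|Ts] := ltP s T.
  by rewrite g00// mul0r sub0r subrr !mul0r.
by field; rewrite !gt_eqF ?q0 ?beta_sub1_gt0.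
Qed.

(** The formula has no multiplicative constant, so the integral must equal [ln (y / G)] exactly.
    Beyond [T + 1] its integrand is the derivative of that function, and [eps] tends to 0 there by
    [cvg_log_derivative_index]. *)
Lemma exponential_formula (b : R) : a <= b -> exists eps : R -> R,
  [/\ eps t @[t --> +oo] --> (0 : R),
    forall t, b <= t -> (leb R).-integrable `[b, t]
      (fun s => ((1 + eps s) * (beta - 1) * q s)%:E) &
    \forall t \near +oo, y t = G t *
      expR (\int[leb R]_(s in `[b, t]) ((1 + eps s) * (beta - 1) * q s))].
Proof.
move=> ab.
pose L t := ln (y t) - ln (G t).
pose L' t := (y t)^-1 * V t - (G t)^-1 * rho t.
have [T0 T00 HT0] : exists2 X : R, 0 < X & forall t, X <= t ->
   [/\ is_derive t (1 : R) L (L' t), {for t, continuous L'}, 0 < q t, 0 < y t & 0 < G t].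
  apply: near_pinfty_ge.
  have H1 := near_solution_V; have H2 := near_V_continuous; have H3 := near_q_D_gt0.
  near=> t.
  have at' : a < t by near: t; apply: nbhs_pinfty_gt; rewrite num_real.
  have [dy yt _ _ _] : [/\ is_derive t (1 : R) y (V t), 0 < y t, 0 < W t,
      is_derive t (1 : R) W (w1 t) & 0 < w1 t] by near: t.
  have cV : {for t, continuous V} by near: t.
  have Gt := R_D_gt0 at'; have dG := R_D_is_derive at'.
  have cy : {for t, continuous y}.
    by have [d _] := dy; exact: derivable1_continuous.
  have cG : {for t, continuous G}.
    by have [d _] := dG; exact: derivable1_continuous.
  split => //; last by near: t.
    exact: (is_deriveB (@is_derive1_comp R (@ln R) y t _ _ (is_derive1_ln yt) dy)
      (@is_derive1_comp R (@ln R) G t _ _ (is_derive1_ln Gt) dG)).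
  apply: cvgB.
    by apply: cvgM => //; apply: cvgV => //; rewrite gt_eqF.
  apply: cvgM; last exact: within_cy_continuous_at rho_cont at'.
  by apply: cvgV => //; rewrite gt_eqF.
pose T := Num.max T0 b.
have bT : b <= T by rewrite le_max lexx orbT.
have TT0 t : T <= t -> T0 <= t by rewrite ge_max => /andP[].
have T1 : T <= T + 1 by rewrite lerDl.
pose c := L (T + 1).
(* The constant [c] on [T, T + 1] produces the initial value of [L]. *)
pose g0 := glue T (fun=> 0) (glue (T + 1) (fun=> c) L').
pose eps s := g0 s / ((beta - 1) * q s) - 1.
have E : (fun s => (1 + eps s) * (beta - 1) * q s) = g0.
  apply: (@relative_eps_cancel _ T) => t; first by rewrite /g0 /glue => ->.
  by move=> /TT0/HT0[].
have cst z u t : (leb R).-integrable `[u, t] (fun=> (z : R)%:E).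
  apply: continuous_compact_integrable; first exact: segment_compact.
  by apply: continuous_subspaceT => ?; exact: cvg_cst.
have FTC t (Tt : T + 1 <= t) := FTC_ray
   (fun t h => let: And5 h0 _ _ _ _ := HT0 t (TT0 t (le_trans T1 h)) in h0)
   (fun t h => let: And5 _ h0 _ _ _ := HT0 t (TT0 t (le_trans T1 h)) in h0) Tt.
have int t : T + 1 <= t -> (leb R).-integrable `[b, t] (fun s => (g0 s)%:E) /\
    \int[leb R]_(s in `[b, t]) g0 s = L t.
  move=> Tt; have [i1 e1] := FTC t Tt.
  have Tt' : T <= t by exact: le_trans Tt.
  have [i2 e2] := glue_integral T1 (Tt : (BLeft (T + 1) <= BRight t)%O)
    (cst c T (T + 1)) i1.
  have [i3 e3] := glue_integral bT (Tt' : (BLeft T <= BRight t)%O) (cst 0 b T) i2.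
  split => //; rewrite e3 e2 e1 !Rintegral_cst//= mul0r add0r.
  rewrite lebesgue_measure_itv/= lte_fin ltrDl ltr01 -EFinB /= addrAC subrr add0r mulr1.
  by rewrite addrC subrK.
exists eps; split.
- have H : L' t / ((beta - 1) * q t) - 1 @[t --> +oo] --> (0 : R).
    rewrite -[X in _ --> X](subrr 1); apply: cvgB; last exact: cvg_cst.
    exact: cvg_log_derivative_index.
  apply: near_eq_cvg_pinfty H; near=> t.
  have Tt : T + 1 <= t by near: t; apply: nbhs_pinfty_ge; rewrite num_real.
  by rewrite /eps /g0 /glue !ltNge Tt (le_trans T1 Tt).
- move=> t bt.
  rewrite -[fun s => _%:E]/(EFin \o (fun s => (1 + eps s) * (beta - 1) * q s)) E.
  (* For [t < T + 1] integrability is restricted from a longer interval. *)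
  have m1 : T + 1 <= Num.max t (T + 1) by rewrite le_max lexx orbT.
  have [i _] := int _ m1.
  by apply: integrableS i => //; apply: subset_itvl; rewrite bnd_simp le_max lexx.
near=> t.
have Tt : T + 1 <= t by near: t; apply: nbhs_pinfty_ge; rewrite num_real.
have [_ _ _ yt Gt] := HT0 _ (TT0 _ (le_trans T1 Tt)).
rewrite E (int t Tt).2 /L expRB !lnK ?posrE//.
by rewrite mulrC divfK// gt_eqF.
Unshelve. all: by end_near. Qed.

(** With integrand [(beta - 1) * (w1 / W)] the inner integral from [s] is
    [(beta - 1) * ln (M / W s)]. The exponential then turns [M ^ (beta - 1)] into
    [W s ^ (beta - 1)], and the outer integrand becomes the derivative of [y]. *)
Lemma tail_formula (b M : R) : a <= b -> W t @[t --> +oo] --> M ->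
  exists (A : R) (eps : R -> R),
    [/\ eps t @[t --> +oo] --> (0 : R),
      (leb R).-integrable `[b, +oo[
        (fun u => ((1 + eps u) * (beta - 1) * q u)%:E) &
      \forall t \near +oo, y t = A + \int[leb R]_(s in `[b, t])
        (M `^ (beta - 1) * r s `^ (1 - beta) *
           expR (- \int[leb R]_(u in `[s, +oo[)
             ((1 + eps u) * (beta - 1) * q u)))].
Proof.
move=> ab WM; have M0 := W_limit_gt0 WM.
have b1 := beta_sub1_gt0.
pose h t := (beta - 1) * (w1 t / W t).
pose H t := (beta - 1) * ln (W t).
have Hlim : H t @[t --> +oo] --> (beta - 1) * ln M.
  apply: cvgM; first exact: cvg_cst.
  by apply: (@continuous_cvg _ _ _ _ _ _ (@ln R)) => //; exact: continuous_ln.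
have [T0 T00 HT0] : exists2 X : R, 0 < X & forall t, X <= t ->
   [/\ is_derive t (1 : R) H (h t), {for t, continuous h}, 0 <= h t, 0 < q t &
    [/\ is_derive t (1 : R) y (V t), {for t, continuous V} & 0 < W t]].
  apply: near_pinfty_ge.
  have H1 := near_solution_V; have H2 := near_V_continuous; have H3 := near_q_D_gt0.
  have H4 := near_log_W; have H5 := near_W'_le.
  near=> t.
  have [dy _ Wt _ _] : [/\ is_derive t (1 : R) y (V t), 0 < y t, 0 < W t,
      is_derive t (1 : R) W (w1 t) & 0 < w1 t] by near: t.
  have [dl cl] : is_derive t (1 : R) (fun t => ln (W t)) (w1 t / W t) /\
    {for t, continuous (fun t => w1 t / W t)} by near: t.
  have [h0 _ _] : [/\ 0 <= w1 t / W t, w1 t / W t <= 2 * q t & q t <= 2 * (w1 t / W t)].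
    by near: t.
  split => //.
  - by have := is_deriveZ (beta - 1) dl.
  - by apply: cvgM => //; exact: cvg_cst.
  - by rewrite /h mulr_ge0// ltW.
  - by near: t.
  - by split => //; near: t.
pose T := Num.max T0 b.
have bT : b <= T by rewrite le_max lexx orbT.
have TT0 t : T <= t -> T0 <= t by rewrite ge_max => /andP[].
have aT : a <= T by exact: le_trans bT.
pose g0 := glue T (fun=> 0) h.
pose eps s := g0 s / ((beta - 1) * q s) - 1.
have E : (fun s => (1 + eps s) * (beta - 1) * q s) = g0.
  apply: (@relative_eps_cancel _ T) => t; first by rewrite /g0 /glue => ->.
  by move=> /TT0/HT0[].
have cst u t : (leb R).-integrable `[u, t] (fun=> (0 : R)%:E).
  apply: continuous_compact_integrable; first exact: segment_compact.
  by apply: continuous_subspaceT => ?; exact: cvg_cst.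
have FTC s (Ts : T <= s) := FTC_ray_pinfty
   (fun t k => let: And5 h0 _ _ _ _ := HT0 t (TT0 t (le_trans Ts k)) in h0)
   (fun t k => let: And5 _ h0 _ _ _ := HT0 t (TT0 t (le_trans Ts k)) in h0)
   (fun t k => let: And5 _ _ h0 _ _ := HT0 t (TT0 t (le_trans Ts k)) in h0) Hlim.
have [iT eT] := FTC T (lexx T).
have int1 s : s <= T -> (leb R).-integrable `[s, +oo[ (fun u => (g0 u)%:E) /\
    \int[leb R]_(u in `[s, +oo[) g0 u = (beta - 1) * ln M - H T.
  move=> sT.
  have [i2 e2] := glue_integral sT (isT : (BLeft T <= BInfty R false)%O) (cst s T) iT.
  by split => //; rewrite e2 eT Rintegral_cst//= mul0r add0r.
have int2 s : T <= s ->
    \int[leb R]_(u in `[s, +oo[) g0 u = (beta - 1) * ln M - H s.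
  move=> Ts; rewrite -(FTC s Ts).2; apply: eq_Rintegral => u.
  by rewrite inE/= in_itv/= andbT => /(le_trans Ts) Tu; rewrite /g0 /glue ltNge Tu.
have expE s : T <= s ->
    M `^ (beta - 1) * expR (- ((beta - 1) * ln M - H s)) = W s `^ (beta - 1).
  move=> /TT0/HT0[_ _ _ _ [_ _ Ws]].
  rewrite opprB expRB /H /powR !gt_eqF// mulrCA mulfV ?mulr1//.
  by rewrite gt_eqF// expR_gt0.
pose J s := M `^ (beta - 1) * r s `^ (1 - beta) *
   expR (- \int[leb R]_(u in `[s, +oo[) ((1 + eps u) * (beta - 1) * q u)).
(* Before [T] the inner integral does not depend on [s], since [g0] vanishes there, and the outer
   integrand is a multiple of [rho]. *)
have JE : J = glue T (fun s => W T `^ (beta - 1) * rho s) V.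
  apply/funext => s; rewrite /J E /glue; have [sT|Ts] := ltP s T.
    by rewrite (int1 _ (ltW sT)).2 mulrAC expE.
  by rewrite int2// mulrAC expE// /V conj_beta_sub1.
have iC : (leb R).-integrable `[b, T] (fun s => (W T `^ (beta - 1) * rho s)%:E).
  suff : (leb R).-integrable `[b, T] (fun s => (W T `^ (beta - 1))%:E * (rho s)%:E)%E by [].
  by apply: integrableZl => //; exact: within_cy_integrable rho_cont ab.
pose C := \int[leb R]_(s in `[b, T]) (W T `^ (beta - 1) * rho s).
(* [C] is the part of the outer integral over [[b, T]], where the integrand need not be the
   derivative of [y]. *)
exists (y T - C), eps; split.
- have K : w1 t / (W t * q t) - 1 @[t --> +oo] --> (0 : R).
    rewrite -[X in _ --> X](subrr 1); apply: cvgB; last exact: cvg_cst.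
    exact: cvg_log_derivative_W.
  apply: near_eq_cvg_pinfty K; near=> t.
  have Tt : T <= t by near: t; apply: nbhs_pinfty_ge; rewrite num_real.
  have [_ _ _ qt [_ _ Wt]] := HT0 _ (TT0 _ Tt).
  rewrite /eps /g0 /glue ltNge Tt /= /h; congr (_ - 1).
  by field; rewrite !gt_eqF.
- rewrite -[fun u => (_ * q u)%:E]/(EFin \o (fun s => (1 + eps s) * (beta - 1) * q s)) E.
  exact: (int1 b bT).1.
near=> t.
have Tt : T <= t by near: t; apply: nbhs_pinfty_ge; rewrite num_real.
rewrite -[X in _ + X]/(\int[leb R]_(s in `[b, t]) J s) JE.
have [iV eV] := FTC_ray (fun t k => let: And5 _ _ _ _ k0 := HT0 t (TT0 t k) in
     let: And3 k1 _ _ := k0 in k1)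
   (fun t k => let: And5 _ _ _ _ k0 := HT0 t (TT0 t k) in let: And3 _ k1 _ := k0 in k1) Tt.
have [_ ->] := glue_integral bT (Tt : (BLeft T <= BRight t)%O) iC iV.
by rewrite eV -/C; ring.
Unshelve. all: by end_near. Qed.

(** Both claims are the tail statement of [solution_asymptotics]. The absolute value opens as
    [M - W] because an increasing function stays below its limit; the quotient is the one in the new
    variable at [s = R_D t], with [s * s ^ (alpha - 1)] collected into [s ^ alpha]. *)
Lemma remainder_asymptotics (M : R) : W t @[t --> +oo] --> M ->
  SV (fun t => `|W (g t) - M|) /\
  (derive1 theta (G t)) `^ (alpha - 1) * G t `^ alpha * p t * r t `^ (beta - 1)
    / (M - W t) @[t --> +oo] --> (0 : R).
Proof.
move=> WM.
have WgM : (W \o g) s @[s --> +oo] --> M by exact: (cvg_comp _ _ R_Dinv_cvg WM).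
have [_ _ _ _ /(_ _ WgM)[T1 T2]] := solution_asymptotics.
have WltM : \forall t \near +oo, W t < M.
  have HV := near_solution_V.
  by apply: (@increasing_lt_limit R W w1 M) => //; apply: filterS HV => t [].
have absE : \forall s \near +oo, M - (W \o g) s = `|W (g s) - M|.
  have H := near_R_Dinv WltM; near=> s.
  by rewrite distrC ger0_norm// subr_ge0 ltW//; near: s.
split.
  split.
  - have [T T0 HT] := near_pinfty_ge near_solution_inv.
    near=> b; have Tb : T <= b by near: b; apply: nbhs_pinfty_ge; rewrite num_real.
    apply: within_cy_measurable; apply: continuous_ray_within => s bs.
    have [_ _ _ [d _]] := HT _ (le_trans Tb bs).
    have cWg := derivable1_continuous d.
    by apply: cvg_norm; apply: cvgB; [exact: cWg|exact: cvg_cst].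
  - have H := near_R_Dinv WltM; near=> s.
    rewrite normr_gt0 subr_eq0 lt_eqF//; near: s; exact: H.
  move=> l l0; rewrite powRr0.
  have H := near_pinfty_scale l0 absE.
  apply: near_eq_cvg_pinfty (T2 l l0); near=> s.
  have e1 : M - (W \o g) s = `|W (g s) - M| by near: s.
  have e2 : M - (W \o g) (l * s) = `|W (g (l * s)) - M| by near: s.
  by rewrite e1 e2.
apply: near_eq_cvg_pinfty (cvg_comp _ _ R_D_cvg T1); near=> t.
have at' : a < t by near: t; apply: nbhs_pinfty_gt; rewrite num_real.
have att : a < tau t by near: t; exact: near_tau_gt.
have Gt := R_D_gt0 at'.
have ft : 0 < f (G t) by apply: theta'_gt0; rewrite ?R_DK ?(ltW at').
rewrite /= R_DK ?(ltW at')// /Q p_D_E ?(ltW at')// powRM ?(ltW ft) ?(ltW Gt)//.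
rewrite -(@mulr_powRB1 _ (G t) alpha) ?(ltW Gt)// ?(lt_trans ltr01)//.
by rewrite -/(f (G t)); congr (_ / _); ring.
Unshelve. all: by end_near. Qed.

Lemma solution_cvg : y t @[t --> +oo] --> (+oo : set_system R).
Proof.
have [H _ _ _ _] := solution_asymptotics.
apply: near_eq_cvg_pinfty (cvg_comp _ _ R_D_cvg H); near=> t.
by rewrite /= R_DK.
Unshelve. all: by end_near. Qed.

End Equation.

Theorem theorem3p6 (R : realType) (a alpha beta : R) (r p tau tau' : R -> R)
  (a_gt0 : 0 < a) (alpha_gt1 : 1 < alpha)
  (conj_alpha_beta : alpha^-1 + beta^-1 = 1)
  (r_cont : {within `[a, +oo[, continuous r})
  (p_cont : {within `[a, +oo[, continuous p})
  (r_gt0 : forall t, a <= t -> 0 < r t)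
  (p_gt0 : forall t, a <= t -> 0 < p t)
  (r_int : (\int[leb R]_(s in `[a, +oo[) (r s `^ (1 - beta))%:E = +oo)%E)
  (p_D_RV : RV (- alpha) (p_D a beta r p))
  (L_p_D : Lpart (- alpha) (p_D a beta r p) t @[t --> +oo] --> 0)
  (tau_C1 : C1_on `[a, +oo[ tau tau')
  (tau'_gt0 : forall t, a <= t -> 0 < tau' t)
  (tau_le : forall t, a <= t -> tau t <= t)
  (* tau_D is defined for all large arguments *)
  (tau_ge : \forall t \near +oo, a <= tau t)
  (tau_D_limsup :
    (limf_esup (fun t : R => (t / tau_D a beta r tau t)%:E) +oo%R < +oo)%E)
  (tau_D'_SV : SV (derive1 (tau_D a beta r tau)))
  (tau_D'_limsup :
    (limf_esup (fun t : R => (derive1 (tau_D a beta r tau) t)%:E) +oo%R < +oo)%E)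
  (y : R -> R) (y_IS : sol_IS a alpha r p tau y) :
  NRV 1 (y \o R_Dinv a beta r) /\
  (* b replaces the lower limit a: tau >= a on [b, oo), so q_D is defined there *)
  forall b : R, a <= b -> a <= tau b ->
  ((\int[leb R]_(s in `[b, +oo[) (q_D a alpha beta r p tau s)%:E = +oo)%E ->
   (exists eps : R -> R,
     [/\ eps t @[t --> +oo] --> 0,
         forall t, b <= t -> (leb R).-integrable `[b, t]
           (fun s => ((1 + eps s) * (beta - 1)
                      * q_D a alpha beta r p tau s)%:E) &
         \forall t \near +oo, y t = R_D a beta r t *
           expR (\int[leb R]_(s in `[b, t])
             ((1 + eps s) * (beta - 1) * q_D a alpha beta r p tau s))]) /\
   sol_ISuv a alpha r p tau LimInfty LimInfty y)
  /\
  ((\int[leb R]_(s in `[b, +oo[) (q_D a alpha beta r p tau s)%:E < +oo)%E ->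
   exists M : R,
     [/\ 0 < M /\ quasi alpha r y t @[t --> +oo] --> M,
         sol_ISuv a alpha r p tau LimInfty LimB y,
         exists (A : R) (eps : R -> R),
           [/\ eps t @[t --> +oo] --> 0,
               (leb R).-integrable `[b, +oo[
                 (fun u => ((1 + eps u) * (beta - 1)
                            * q_D a alpha beta r p tau u)%:E) &
               \forall t \near +oo, y t = A +
                 \int[leb R]_(s in `[b, t])
                   (M `^ (beta - 1) * r s `^ (1 - beta) *
                    expR (- \int[leb R]_(u in `[s, +oo[)
                      ((1 + eps u) * (beta - 1)
                       * q_D a alpha beta r p tau u)))],
         SV (fun t => `|quasi alpha r y (R_Dinv a beta r t) - M|) &
         (derive1 (tau_D a beta r tau) (R_D a beta r t)) `^ (alpha - 1)
           * R_D a beta r t `^ alpha * p t * r t `^ (beta - 1)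
           / (M - quasi alpha r y t) @[t --> +oo] --> 0]).
Proof.
have y_lim : y t @[t --> +oo] --> (+oo : set_system R).
  exact: (@solution_cvg R a alpha beta r p tau tau').
split; first exact: (@NRV_solution R a alpha beta r p tau tau').
move=> b ab atb; split=> [intq|intq].
  split; first exact: (@exponential_formula R a alpha beta r p tau tau').
  split => //.
  exact: (@W_pinfty R a alpha beta r p tau tau' _ _ _ _ _ _ _ _ _ _ _ _ _ _ _ y y_IS b).
have [M [M0 WM]] : exists M : R, 0 < M /\ quasi alpha r y t @[t --> +oo] --> M.
  exact: (@W_finite R a alpha beta r p tau tau' _ _ _ _ _ _ _ _ _ _ _ _ _ _ _ y y_IS b).
have [SVM limM] : SV (fun t => `|quasi alpha r y (R_Dinv a beta r t) - M|) /\
  (derive1 (tau_D a beta r tau) (R_D a beta r t)) `^ (alpha - 1)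
    * R_D a beta r t `^ alpha * p t * r t `^ (beta - 1)
    / (M - quasi alpha r y t) @[t --> +oo] --> 0.
  exact: (@remainder_asymptotics R a alpha beta r p tau tau').
exists M; split => //.
  by split => //; exists M => //; rewrite gt_eqF.
exact: (@tail_formula R a alpha beta r p tau tau').
Qed.
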